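(* Let $n=2$. Let $\hat x=(\hat r,\hat q,\hat p)\in X_h$ be the solution of $\langle \mathcal{B}\hat x,\tilde x\rangle=\langle f,\tilde x\rangle$ for all $\tilde x\in X_h$, and let $x_h=(r_h,q_h,p_h)\in X_h$ be the solution of the problem with quadrature $\langle \mathcal{B}_h x_h,\tilde x\rangle=\langle f,\tilde x\rangle$ for all $\tilde x\in X_h$. Then $x_h$ converges quadratically to $\hat x$; in particular, $$\|\hat x-x_h\|_E=\|\hat q-q_h\|\lesssim h^2 .$$
   Context: Setting. $\Omega\subset\mathbb{R}^2$ is a simply connected Lipschitz domain with outward unit normal $\nu$; $\mu>0$ is a constant; $g\in (L^2(\Omega))^2$. The boundary is disjointly decomposed as $\partial\Omega=\partial_p\Omega\cup\partial_q\Omega$, and boundary data $p_0,q_0$ are given (such that the functional $f$ below is bounded). It is assumed that $\partial_p\Omega\neq\emptyset$ and $\|\nu\cdot\phi\|_{\partial_q\Omega}+\|\nu\times\phi\|_{\partial_p\Omega}>0$ for all rigid body motions $\phi\neq0$. $\|\cdot\|$ and $\langle\cdot,\cdot\rangle_\Omega$ are the $L^2(\Omega)$ norm and inner product. In two dimensions $\nabla\times r=[\partial_2 r,-\partial_1 r]^T$ for scalar $r$, $\nabla\times q=\partial_1q_2-\partial_2q_1$ for vector $q$, the cross product with $\nu$ is defined analogously, and the vorticity $r$ is a scalar. Continuous spaces and forms. $X=R\times Q\times P$ with $R=\{r\in H(\mathrm{curl},\Omega):\nu\times r|_{\partial_q\Omega}=0\}$, $Q=\{q\in H(\mathrm{div},\Omega):\nu\cdot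 q|_{\partial_q\Omega}=0\}$, $P=L^2(\Omega)$. For $x=(r,q,p)$, $\tilde x=(\tilde r,\tilde q,\tilde p)\in X$, $$\langle\mathcal{B}x,\tilde x\rangle=\langle\mu^{-1}r,\tilde r\rangle_\Omega-\langle q,\nabla\times\tilde r\rangle_\Omega+\langle\nabla\times r,\tilde q\rangle_\Omega-\langle p,\nabla\cdot\tilde q\rangle_\Omega+\langle\nabla\cdot q,\tilde p\rangle_\Omega,$$ $$\langle f,\tilde x\rangle=\langle q_0,\nu\times\tilde r\rangle_{\partial_p\Omega}+\langle g,\tilde q\rangle_\Omega-\langle p_0,\nu\cdot\tilde q\rangle_{\partial_p\Omega}.$$ The energy norm is $\|(r,q,p)\|_E^2=\|r\|^2+\|\nabla\times r\|^2+\|q\|^2+\|\nabla\cdot q\|^2+\|p\|^2$. The paper recalls from the literature that the continuous problem $\langle\mathcal{B}x,\tilde x\rangle=\langle f,\tilde x\rangle$ for all $\tilde x\in X$ has a unique solution bounded in the energy norm, and that the discrete problem for $\hat x$ is stable. Discretization. $\Omega_h$ is a triangular mesh of $\Omega$ (from a shape-regular family) with mesh size $h$. $X_h=R_h\times Q_h\times P_h$, where $R_h$ is the space of continuous piecewise linear Lagrange elements intersected with $R$, $Q_h$ is the lowest-order Raviart–Thomas space intersected with $Q$, and $P_h$ is the space of piecewise constants. One has $\nabla\times R_h\subseteq Q_h$ and $\nabla\cdot Q_h=P_h$. Quadrature. For elementwise linear (possibly discontinuous) scalar functions $r,\tilde r$ on $\Omega_h$, $$\langle r,\tilde r\rangle_h=\sum_{\omega\in\Omega_h}\frac{|\omega|}{3}\sum_{v\in\mathcal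 V(\omega)}(r_\omega\,\tilde r_\omega)(v),$$ with $r_\omega$ the restriction of $r$ to the triangle $\omega$ and $\mathcal V(\omega)$ its set of vertices. $\mathcal{B}_h$ is obtained from $\mathcal{B}$ on $X_h$ by replacing $\langle\mu^{-1}r,\tilde r\rangle_\Omega$ by $\langle\mu^{-1}r,\tilde r\rangle_h$. Notation. $a\lesssim b$ means $Ca\le b$ for some constant $C>0$ independent of the mesh size $h$ (here the constant may depend on the data $f$). *)

(* Defs.v *)
From HB Require Import structures.
From mathcomp Require Import all_boot all_order all_algebra.
From mathcomp Require Import all_classical all_reals all_analysis.
Set Implicit Arguments.
Unset Strict Implicit.
Unset Printing Implicit Defensive.
Import Order.TTheory GRing.Theory Num.Theory.
Import numFieldNormedType.Exports.
Local Open Scope classical_set_scope.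
Local Open Scope ring_scope.

(** The plane.  [plane R] carries the topology and the (componentwise) vector
    space structure; [mplane R] is convertible to it and carries the Borel
    sigma-algebra on which [lebesgue_measure] lives.  The norm that the library
    puts on a product is the max norm, so the Euclidean one is defined here. *)

Notation plane R := (R * R)%type.
Notation mplane R := (measurableTypeR R * measurableTypeR R)%type.
Notation scalar_field R := (plane R -> R).
Notation vector_field R := (plane R -> plane R).

Definition leb2 (R : realType) : {measure set (mplane R) -> \bar R} :=
  (@lebesgue_measure R \x @lebesgue_measure R)%E.

Definition dot (R : realType) (a b : plane R) : R := a.1 * b.1 + a.2 * b.2.
Definition cross (R : realType) (a b : plane R) : R := a.1 * b.2 - a.2 * b.1.
(* [n x r] for a scalar [r], the analogue of [curl r = (d_2 r, - d_1 r)] *)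
Definition cross_scalar (R : realType) (n : plane R) (r : R) : plane R :=
  (n.2 * r, - (n.1 * r)).
Definition enorm (R : realType) (a : plane R) : R := Num.sqrt (dot a a).

(* The singleton 0 makes the diameter of the empty set equal to 0. *)
Definition ediam (R : realType) (A : set (plane R)) : \bar R :=
  ereal_sup ([set 0%E] `|`
    [set (enorm (z.1 - z.2))%:E | z in [set z : plane R * plane R | A z.1 /\ A z.2]]).

Definition bdry (R : realType) (A : set (plane R)) : set (plane R) :=
  closure A `\` A°.

Definition lipschitz_domain (R : realType) (Om : set (plane R)) : Prop :=
  [/\ open Om, Om !=set0, connected Om, bounded_set Om &
   forall x, bdry Om x ->
     exists (c s d L : R) (gam : R -> R),
       [/\ c ^+ 2 + s ^+ 2 = 1, 0 < d,
           forall a b, `|gam a - gam b| <= L * `|a - b| &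
           forall a b, `|a| < d -> `|b| < d ->
             (Om (x + (c * a - s * b, s * a + c * b)) <-> gam a < b)]].

(* every loop in the (connected) set is freely homotopic to a constant *)
Definition simply_connected (R : realType) (Om : set (plane R)) : Prop :=
  connected Om /\
  forall gam : R -> plane R,
    {within `[0, 1]%classic, continuous gam} ->
    (forall t, `[0, 1]%classic t -> Om (gam t)) -> gam 0 = gam 1 ->
    exists (H : plane R -> plane R) (x0 : plane R),
      let sq := `[0, 1]%classic `*` `[0, 1]%classic in
      [/\ {within sq, continuous H},
          forall z, sq z -> Om (H z),
          forall t, `[0, 1]%classic t -> H (t, 0) = gam t,
          forall t, `[0, 1]%classic t -> H (t, 1) = x0 &
          forall s, `[0, 1]%classic s -> H (0, s) = H (1, s)].

Definition hausdorff1 (R : realType) (A : set (plane R)) : \bar R :=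
  ereal_sup [set ereal_inf
      [set (\sum_(0 <= k <oo) ediam (U k))%E | U in
         [set U : nat -> set (plane R) |
            A `<=` \bigcup_k U k /\ forall k, (ediam (U k) <= d%:E)%E]]
    | d in [set d : R | 0 < d]].

Definition surface_measure (R : realType) (Om : set (plane R))
    (sg : {measure set (mplane R) -> \bar R}) : Prop :=
  forall A : set (mplane R), measurable A -> sg A = hausdorff1 (A `&` bdry Om).

(* [n] is the outward unit normal at [x] when, near [x], [Om] is the half plane
   [(y - x) . n < 0] up to a cone of arbitrarily small opening; for a Lipschitz
   domain this determines [n] and holds almost everywhere on the boundary. *)
Definition is_outward_normal (R : realType) (Om : set (plane R))
    (x n : plane R) : Prop :=
  enorm n = 1 /\
  forall e : R, 0 < e -> \forall y \near x,
    (dot n (y - x) < - (e * enorm (y - x)) -> Om y) /\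
    (e * enorm (y - x) < dot n (y - x) -> ~ closure Om y).

Definition normal (R : realType) (Om : set (plane R)) (x : plane R) : plane R :=
  xget 0 [set n | is_outward_normal Om x n].

Section L2.
Context (R : realType) (m : {measure set (mplane R) -> \bar R}).
Implicit Types (D : set (plane R)).

Definition ip D (u v : scalar_field R) : R := \int[m]_(x in D) (u x * v x).
Definition ipv D (u v : vector_field R) : R := \int[m]_(x in D) dot (u x) (v x).
Definition L2norm D (u : scalar_field R) : R := Num.sqrt (ip D u u).
Definition L2normv D (u : vector_field R) : R := Num.sqrt (ipv D u u).

Definition inL2 D (u : scalar_field R) : Prop :=
  measurable_fun (D : set (mplane R)) u /\
  (\int[m]_(x in D) (u x ^+ 2)%:E < +oo)%E.
Definition inL2v D (u : vector_field R) : Prop :=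
  inL2 D (fst \o u) /\ inL2 D (snd \o u).

End L2.

Section WeakDerivatives.
Context (R : realType).
Implicit Types (Om G : set (plane R)) (phi r : scalar_field R)
  (psi q : vector_field R).

Definition d1 phi : scalar_field R := 'D_((1, 0) : plane R) phi.
Definition d2 phi : scalar_field R := 'D_((0, 1) : plane R) phi.

Fixpoint Ck (k : nat) phi : Prop :=
  match k with
  | 0 => continuous phi
  | k'.+1 => [/\ continuous phi,
      forall x, derivable phi x ((1, 0) : plane R) /\
                derivable phi x ((0, 1) : plane R),
      Ck k' (d1 phi) & Ck k' (d2 phi)]
  end.

Definition smooth phi : Prop := forall k, Ck k phi.
Definition smoothv psi : Prop := smooth (fst \o psi) /\ smooth (snd \o psi).

Definition grad phi : vector_field R := fun x => (d1 phi x, d2 phi x).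
Definition rot psi : scalar_field R :=
  fun x => d1 (snd \o psi) x - d2 (fst \o psi) x.

Definition cpt_supp (V : zmodType) Om (u : plane R -> V) : Prop :=
  exists K, [/\ compact K, K `<=` Om & forall x, ~ K x -> u x = 0].
Definition vanishes_near (V : zmodType) G (u : plane R -> V) : Prop :=
  exists U, [/\ open U, G `<=` U & forall x, U x -> u x = 0].

Definition weak_curl Om r (c : vector_field R) : Prop :=
  inL2v (@leb2 R) Om c /\
  forall psi, smoothv psi -> cpt_supp Om psi ->
    ip (@leb2 R) Om r (rot psi) = ipv (@leb2 R) Om c psi.
Definition weak_div Om q (d : scalar_field R) : Prop :=
  inL2 (@leb2 R) Om d /\
  forall phi, smooth phi -> cpt_supp Om phi ->
    ipv (@leb2 R) Om q (grad phi) = - ip (@leb2 R) Om d phi.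

Definition Hcurl Om r : Prop :=
  inL2 (@leb2 R) Om r /\ exists c, weak_curl Om r c.
Definition Hdiv Om q : Prop :=
  inL2v (@leb2 R) Om q /\ exists d, weak_div Om q d.

(* representatives, determined almost everywhere in [Om] *)
Definition curl Om r : vector_field R :=
  xget (cst 0) [set c | weak_curl Om r c].
Definition div Om q : scalar_field R :=
  xget (cst 0) [set d | weak_div Om q d].

(** Green's formulas define the boundary values: [t] is the trace of [r], and
    [u] the normal trace of [q]. *)
Definition green_curl Om r psi : R :=
  ip (@leb2 R) Om r (rot psi) - ipv (@leb2 R) Om (curl Om r) psi.
Definition green_div Om q phi : R :=
  ipv (@leb2 R) Om q (grad phi) + ip (@leb2 R) Om (div Om q) phi.

Definition bounded_on_bdry Om (t : scalar_field R) : Prop :=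
  measurable_fun (bdry Om : set (mplane R)) t /\
  exists K, forall x, bdry Om x -> `|t x| <= K.

Definition is_trace (sg : {measure set (mplane R) -> \bar R}) Om r t : Prop :=
  bounded_on_bdry Om t /\
  forall psi, smoothv psi ->
    green_curl Om r psi =
    \int[sg]_(x in bdry Om) (t x * cross (normal Om x) (psi x)).
Definition is_normal_trace (sg : {measure set (mplane R) -> \bar R}) Om q u
    : Prop :=
  bounded_on_bdry Om u /\
  forall phi, smooth phi ->
    green_div Om q phi = \int[sg]_(x in bdry Om) (u x * phi x).

End WeakDerivatives.

(** The continuous spaces and forms.  [Gp] is the part of the boundary called
    d_p Omega.  The conditions [nu x r = 0] and [nu . q = 0] on the remaining
    part d_q Omega are meant in the weak sense: the boundary pairing vanishes
    on the test functions supported away from [Gp]. *)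

Section Problem.
Context (R : realType).
Implicit Types (Om Gp : set (plane R)).

Definition triple := (scalar_field R * vector_field R * scalar_field R)%type.
Definition rr (x : triple) : scalar_field R := x.1.1.
Definition qq (x : triple) : vector_field R := x.1.2.
Definition pp (x : triple) : scalar_field R := x.2.

Definition spaceR Om Gp (r : scalar_field R) : Prop :=
  Hcurl Om r /\
  forall psi, smoothv psi -> vanishes_near Gp psi -> green_curl Om r psi = 0.
Definition spaceQ Om Gp (q : vector_field R) : Prop :=
  Hdiv Om q /\
  forall phi, smooth phi -> vanishes_near Gp phi -> green_div Om q phi = 0.
Definition spaceP Om (p : scalar_field R) : Prop := inL2 (@leb2 R) Om p.
Definition spaceX Om Gp : set triple :=
  [set x | [/\ spaceR Om Gp (rr x), spaceQ Om Gp (qq x) & spaceP Om (pp x)]].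

(* [m x y] is the form in the place of [<mu^-1 r, r~>] *)
Definition Bgen (m : scalar_field R -> scalar_field R -> R) Om (x y : triple)
    : R :=
  m (rr x) (rr y)
  - ipv (@leb2 R) Om (qq x) (curl Om (rr y))
  + ipv (@leb2 R) Om (curl Om (rr x)) (qq y)
  - ip (@leb2 R) Om (pp x) (div Om (qq y))
  + ip (@leb2 R) Om (div Om (qq x)) (pp y).

Definition B (mu : R) Om : triple -> triple -> R :=
  Bgen (fun r s => ip (@leb2 R) Om (fun z => mu^-1 * r z) s) Om.

Definition Enorm Om (x : triple) : R :=
  Num.sqrt (L2norm (@leb2 R) Om (rr x) ^+ 2
          + L2normv (@leb2 R) Om (curl Om (rr x)) ^+ 2
          + L2normv (@leb2 R) Om (qq x) ^+ 2
          + L2norm (@leb2 R) Om (div Om (qq x)) ^+ 2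
          + L2norm (@leb2 R) Om (pp x) ^+ 2).

(* [f] is a bounded linear functional on [X], equal to
   [<q0, nu x r~>_Gp + <g, q~> - <p0, nu . q~>_Gp] whenever [r~] and [q~] have
   bounded boundary values, as finite element functions do.  On a general
   element of [X] the boundary terms are duality pairings, not integrals. *)
Definition load_functional (sg : {measure set (mplane R) -> \bar R})
    Om Gp (g : vector_field R) (p0 : scalar_field R) (q0 : vector_field R)
    (f : triple -> R) : Prop :=
  [/\ forall (a : R) x y, spaceX Om Gp x -> spaceX Om Gp y ->
        f (a *: x + y) = a * f x + f y,
      exists M : R, forall x, spaceX Om Gp x -> `|f x| <= M * Enorm Om x &
      forall x t u, spaceX Om Gp x ->
        is_trace sg Om (rr x) t -> is_normal_trace sg Om (qq x) u ->
        f x = \int[sg]_(z in Gp) dot (q0 z) (cross_scalar (normal Om z) (t z))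
              + ipv (@leb2 R) Om g (qq x)
              - \int[sg]_(z in Gp) (p0 z * u z)].

End Problem.

Section Mesh.
Context (R : realType).

Record mesh := Mesh { ntri : nat; vtx : 'I_ntri -> 'I_3 -> plane R }.

(* convex hull of those vertices of the triangle [T] that lie in [S] *)
Definition hull3 (T : 'I_3 -> plane R) (S : set (plane R)) : set (plane R) :=
  [set x | exists l : 'I_3 -> R,
     [/\ forall i, 0 <= l i, \sum_i l i = 1, forall i, ~ S (T i) -> l i = 0 &
         x = \sum_i l i *: T i]].

Definition tri (T : mesh) (k : 'I_(ntri T)) : set (plane R) :=
  hull3 (vtx k) setT.

(* Conforming triangulation: non-degenerate triangles, two of which have
   disjoint interiors and meet exactly in the hull of their common vertices
   (nothing, a vertex or an edge). *)
Definition mesh_of (Om : set (plane R)) (T : mesh) : Prop :=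
  [/\ forall k : 'I_(ntri T),
        cross (vtx k (inord 1) - vtx k ord0) (vtx k (inord 2) - vtx k ord0) != 0,
      closure Om = \bigcup_(k in [set: 'I_(ntri T)]) tri k,
      forall k : 'I_(ntri T), (tri k)° `<=` Om,
      forall k l : 'I_(ntri T), k != l -> (tri k)° `&` (tri l)° = set0 &
      forall k l : 'I_(ntri T), k != l ->
        tri k `&` tri l = hull3 (vtx k) (range (vtx l))].

Definition tri_diam (T : mesh) (k : 'I_(ntri T)) : R := fine (ediam (tri k)).

Definition mesh_size (T : mesh) : R :=
  \big[Num.max/0]_(k < ntri T) tri_diam k.

(* every triangle contains a disc of radius at least [diam / kap] *)
Definition shape_regular (kap : R) (T : mesh) : Prop :=
  forall k : 'I_(ntri T), exists (c : plane R) (rho : R),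
    [/\ 0 < rho, [set x | enorm (x - c) < rho] `<=` tri k &
        tri_diam k <= kap * rho].

Implicit Types (Om Gp : set (plane R)) (T : mesh).

Definition spaceRh Om Gp T (r : scalar_field R) : Prop :=
  [/\ spaceR Om Gp r, {within closure Om, continuous r} &
      forall k : 'I_(ntri T), exists (a : R) (b : plane R),
        forall x, tri k x -> r x = a + dot b x].
(* normal continuity across the edges is contained in [spaceQ], i.e. in Hdiv *)
Definition spaceQh Om Gp T (q : vector_field R) : Prop :=
  spaceQ Om Gp q /\
  forall k : 'I_(ntri T), exists (a : plane R) (b : R),
    forall x, (tri k)° x -> q x = a + b *: x.
Definition spacePh Om T (p : scalar_field R) : Prop :=
  spaceP Om p /\
  forall k : 'I_(ntri T), exists a : R, forall x, (tri k)° x -> p x = a.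
Definition spaceXh Om Gp T : set (triple R) :=
  [set x | [/\ spaceRh Om Gp T (rr x), spaceQh Om Gp T (qq x) &
               spacePh Om T (pp x)]].

(* An elementwise linear, possibly discontinuous, function is the family of its
   restrictions to the closed triangles. *)
Definition quad T (r s : 'I_(ntri T) -> scalar_field R) : R :=
  \sum_(k < ntri T) fine (leb2 R (tri k)) / 3%:R *
    \sum_(i < 3) r k (vtx k i) * s k (vtx k i).

Definition Bh (mu : R) Om T : triple R -> triple R -> R :=
  Bgen (fun r s => quad (fun k z => mu^-1 * r z) (fun k : 'I_(ntri T) => s)) Om.

Definition solves (b : triple R -> triple R -> R) (f : triple R -> R)
    (V : set (triple R)) (x : triple R) : Prop :=
  V x /\ forall y, V y -> b x y = f y.

(* Stability of the discrete problems without quadrature: a discrete solution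
   is bounded, uniformly in the mesh, by the dual norm of its right-hand side. *)
Definition uniformly_stable (mu : R) Om Gp (I : Type) (Th : I -> mesh) : Prop :=
  exists C : R, forall (i : I) (x : triple R) (M : R),
    spaceXh Om Gp (Th i) x -> 0 <= M ->
    (forall y, spaceXh Om Gp (Th i) y -> `|B mu Om x y| <= M * Enorm Om y) ->
    Enorm Om x <= C * M.

End Mesh.

(* Main.v *)
Require Import Defs.
From HB Require Import structures.
From mathcomp Require Import all_boot all_order all_algebra.
From mathcomp Require Import all_classical all_reals all_analysis.
From mathcomp Require Import measurable_realfun.
From mathcomp Require Import ring lra.
Import Order.TTheory GRing.Theory Num.Theory.
Import numFieldNormedType.Exports.
Local Open Scope classical_set_scope.
Local Open Scope ring_scope.
Set Implicit Arguments.
Unset Strict Implicit.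
Unset Printing Implicit Defensive.

(** The quadrature touches only the first equation, so the error
    [e = (e_r, e_q, e_p)], the difference of the two discrete solutions,
    satisfies, for all test functions,
    [mu^-1 (<r, s> - <r_h, s>_h) - <e_q, curl s> + <curl e_r, v>
     - <e_p, div v> + <div e_q, w> = 0]  ([error_identity]).

    The discrete spaces form a complex, and this lets the error test itself.
    The curl of [e_r] is a divergence free element of [Q_h]; taking it for [v]
    gives [curl e_r = 0] ([curl_error]).  The divergence of [e_q] is an element
    of [P_h]; taking it for [w] gives [div e_q = 0] ([div_error]).  What is left
    of the second equation says that [e_p] is orthogonal to all [div v], so that
    [(0, 0, e_p)] is a discrete solution with zero data and the assumed
    stability gives [e_p = 0].  Finally [e_r] is elementwise constant, and the
    vertex rule is exact on affine functions; taking [s = e_r] gives [e_r = 0]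
    ([vorticity_error]).  Hence the energy norm of the error is the norm of
    [e_q].

    For the rate, the residual of the error in the scheme without quadrature is
    [mu^-1] times the quadrature error of [r_h] against [s]
    ([error_residual]).  On a triangle the vertex rule integrates affine
    functions exactly ([integral_affine]), so its error on a product of two
    affine functions comes from their oscillations about the centroid and is at
    most [2 h^2 |T|] times the product of the slopes ([vertex_rule_error]).
    Summing up, it is bounded by [2 h^2 |curl r| |curl s|] ([quad_error]), and
    stability, used once for the error and once for the solution, concludes.

    Two analytic facts are behind these few lines.  The operators [curl] and
    [div] select an arbitrary representative of a weak derivative, so that
    their linearity, and their agreement with the elementwise derivatives, hold
    almost everywhere and only because weak derivatives are unique.  This is
    the fundamental lemma of the calculus of variations
    ([test_functions_ae0]), for which smooth functions with compact support are
    built from [exp (- 1 / x)].  And exactness of the vertex rule on affine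
    functions amounts to the equality of the integrals of the three barycentric
    coordinates; it follows from the affine reflections that exchange two
    vertices, which preserve area ([leb2_reflection]). *)

(** * Square integrable functions *)

Section SquareIntegrable.
Context (R : realType) (m : {measure set (mplane R) -> \bar R}).
Variables (D : set (mplane R)) (mD : measurable D).
Implicit Types u v w : scalar_field R.

Lemma inL2_integrable_mul u v :
  inL2 m D u -> inL2 m D v -> m.-integrable D (EFin \o (fun x => u x * v x)).
Proof.
move=> [mu iu] [mv iv].
have mu2 : measurable_fun D (fun x => u x ^+ 2) by exact: measurable_funX.
have mv2 : measurable_fun D (fun x => v x ^+ 2) by exact: measurable_funX.
have iu2 : m.-integrable D (EFin \o (fun x => u x ^+ 2)).
  apply/integrableP; split; first exact/measurable_EFinP.
  by under eq_integral do rewrite /= ger0_norm ?sqr_ge0//.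
have iv2 : m.-integrable D (EFin \o (fun x => v x ^+ 2)).
  apply/integrableP; split; first exact/measurable_EFinP.
  by under eq_integral do rewrite /= ger0_norm ?sqr_ge0//.
apply: (le_integrable mD _ _ (integrableD mD iu2 iv2)).
  by apply/measurable_EFinP; exact: measurable_funM.
move=> x Dx /=; rewrite lee_fin normrM.
rewrite [leRHS]ger0_norm ?addr_ge0 ?sqr_ge0//.
rewrite -(real_normK (num_real (u x))) -(real_normK (num_real (v x))).
have := normr_ge0 (u x); have := normr_ge0 (v x).
by set a := `|u x|; set b := `|v x|; nra.
Qed.

Lemma inL2P u : measurable_fun D u ->
  m.-integrable D (EFin \o (fun x => u x * u x)) -> inL2 m D u.
Proof.
move=> mu /integrableP[_]; split=> //; move: b; congr (_ < _)%E.
by apply: eq_integral => x _ /=; rewrite expr2 ger0_norm// -expr2 sqr_ge0.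
Qed.

Lemma inL2_cst0 : inL2 m D (cst 0).
Proof.
split; first exact: measurable_cst.
by under eq_integral do rewrite expr0n/=; rewrite integral0 ltry.
Qed.

Lemma inL2Z a u : inL2 m D u -> inL2 m D (fun x => a * u x).
Proof.
move=> hu; apply: inL2P; first by apply: measurable_funM => //; case: hu.
have := integrableZl mD (a * a) (inL2_integrable_mul hu hu).
by apply: eq_integrable => // x _ /=; rewrite -EFinM; congr EFin; ring.
Qed.

Lemma inL2D u v : inL2 m D u -> inL2 m D v -> inL2 m D (fun x => u x + v x).
Proof.
move=> hu hv; apply: inL2P.
  by apply: measurable_funD; [case: hu|case: hv].
have iuu := inL2_integrable_mul hu hu; have ivv := inL2_integrable_mul hv hv.
have iuv := inL2_integrable_mul hu hv.
have := integrableD mD (integrableD mD iuu ivv) (integrableZl mD 2 iuv).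
by apply: eq_integrable => // x _ /=; rewrite -EFinM -!EFinD; congr EFin; ring.
Qed.

Lemma inL2B u v : inL2 m D u -> inL2 m D v -> inL2 m D (fun x => u x - v x).
Proof.
move=> hu hv; have := inL2D hu (inL2Z (-1) hv); congr inL2.
by apply/funext => x; rewrite mulN1r.
Qed.

Lemma ipC u v : ip m D u v = ip m D v u.
Proof. by rewrite /ip; apply: eq_Rintegral => x _; rewrite mulrC. Qed.

Lemma ip_ge0 u : 0 <= ip m D u u.
Proof. by apply: Rintegral_ge0 => x _; rewrite -expr2 sqr_ge0. Qed.

Lemma ipZl a u w : inL2 m D u -> inL2 m D w ->
  ip m D (fun x => a * u x) w = a * ip m D u w.
Proof.
move=> hu hw; rewrite /ip -RintegralZl//; last exact: inL2_integrable_mul.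
by apply: eq_Rintegral => x _; rewrite mulrA.
Qed.

Lemma ipBl u v w : inL2 m D u -> inL2 m D v -> inL2 m D w ->
  ip m D (fun x => u x - v x) w = ip m D u w - ip m D v w.
Proof.
move=> hu hv hw; rewrite /ip -RintegralB//; [|exact: inL2_integrable_mul..].
by apply: eq_Rintegral => x _; rewrite mulrBl.
Qed.

Lemma ip0l w : ip m D (cst 0) w = 0.
Proof.
rewrite /ip (@eq_Rintegral _ _ _ m D (cst 0)); first by rewrite Rintegral_cst// mul0r.
by move=> x _; rewrite mul0r.
Qed.

Lemma eq_ae_Rintegral (f g : mplane R -> R) :
  measurable_fun D f -> measurable_fun D g -> ae_eq m D f g ->
  \int[m]_(x in D) f x = \int[m]_(x in D) g x.
Proof.
move=> mf mg fg; rewrite /Rintegral; congr fine.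
apply: ae_eq_integral => //; [exact/measurable_EFinP|exact/measurable_EFinP|].
by apply: filterS fg => x /[apply] ->.
Qed.

Lemma ip_ael u v w : measurable_fun D u -> measurable_fun D v ->
  measurable_fun D w -> ae_eq m D u v -> ip m D u w = ip m D v w.
Proof.
move=> mu mv mw uv; apply: eq_ae_Rintegral; [exact: measurable_funM..|].
by apply: filterS uv => x /[apply] ->.
Qed.

End SquareIntegrable.

(** Applied to [a = |u|^2], [b = <u, v>] and [c = |v|^2] for an inner product:
    the hypothesis then says that [|u - t v|^2] is nonnegative.  This serves the
    L2 inner product, the dot product and weighted finite sums alike. *)
Lemma discriminant_le (R : rcfType) (a b c : R) : 0 <= a -> 0 <= c ->
  (forall t, 0 <= a - t * b *+ 2 + t ^+ 2 * c) ->
  `|b| <= Num.sqrt a * Num.sqrt c.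
Proof.
move=> a0 c0 h; rewrite -sqrtrM//.
rewrite -sqrtr_sqr ler_sqrt ?mulr_ge0//.
have [c00|cneq] := eqVneq c 0.
  rewrite c00 mulr0; have [->|bneq] := eqVneq b 0; first by rewrite expr0n.
  have := h ((a + 1) / b); rewrite c00 mulr0 addr0 divfK//; lra.
have cpos : 0 < c by rewrite lt_def cneq.
have := h (b / c); rewrite (_ : a - _ + _ = a - b ^+ 2 / c); last by field.
by rewrite subr_ge0 ler_pdivrMr.
Qed.

Section SquareIntegrableVector.
Context (R : realType) (m : {measure set (mplane R) -> \bar R}).
Variables (D : set (mplane R)) (mD : measurable D).
Implicit Types u v w : vector_field R.

Lemma ipvE u v : inL2v m D u -> inL2v m D v ->
  ipv m D u v = ip m D (fst \o u) (fst \o v) + ip m D (snd \o u) (snd \o v).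
Proof.
by move=> [u1 u2] [v1 v2]; rewrite /ip -RintegralD//; exact: inL2_integrable_mul.
Qed.

Lemma inL2vZ a u : inL2v m D u -> inL2v m D (fun x => a *: u x).
Proof. by move=> [u1 u2]; split; exact: inL2Z. Qed.

Lemma inL2vB u v : inL2v m D u -> inL2v m D v -> inL2v m D (fun x => u x - v x).
Proof. by move=> [u1 u2] [v1 v2]; split; exact: inL2B. Qed.

Lemma inL2v_cst0 : inL2v m D (cst 0).
Proof. by split; exact: inL2_cst0. Qed.

Lemma ipvC u v : ipv m D u v = ipv m D v u.
Proof.
by rewrite /ipv; apply: eq_Rintegral => x _; rewrite /dot; congr (_ + _); rewrite mulrC.
Qed.

Lemma ipv_ge0 u : 0 <= ipv m D u u.
Proof.
by apply: Rintegral_ge0 => x _; rewrite /dot -!expr2 addr_ge0 ?sqr_ge0.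
Qed.

Lemma ipvZl a u w : inL2v m D u -> inL2v m D w ->
  ipv m D (fun x => a *: u x) w = a * ipv m D u w.
Proof.
move=> hu hw; rewrite !ipvE//; last exact: inL2vZ.
case: hu hw => [u1 u2] [w1 w2].
have -> := ipZl mD a u1 w1; have -> := ipZl mD a u2 w2; ring.
Qed.

Lemma ipvBl u v w : inL2v m D u -> inL2v m D v -> inL2v m D w ->
  ipv m D (fun x => u x - v x) w = ipv m D u w - ipv m D v w.
Proof.
move=> hu hv hw; rewrite !ipvE//; last exact: inL2vB.
case: hu hv hw => [u1 u2] [v1 v2] [w1 w2].
have -> := ipBl mD u1 v1 w1; have -> := ipBl mD u2 v2 w2; ring.
Qed.

Lemma ipv0l w : ipv m D (cst 0) w = 0.
Proof.
rewrite /ipv (@eq_Rintegral _ _ _ m D (cst 0)); first by rewrite Rintegral_cst// mul0r.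
by move=> x _; rewrite /dot /= !mul0r addr0.
Qed.

Lemma ae_eq_fst u v : ae_eq m D u v -> ae_eq m D (fst \o u) (fst \o v).
Proof. by apply: filterS => x /[apply] /= ->. Qed.

Lemma ae_eq_snd u v : ae_eq m D u v -> ae_eq m D (snd \o u) (snd \o v).
Proof. by apply: filterS => x /[apply] /= ->. Qed.

Lemma ipv_ael u v w : inL2v m D u -> inL2v m D v -> inL2v m D w ->
  ae_eq m D u v -> ipv m D u w = ipv m D v w.
Proof.
move=> hu hv hw uv; rewrite !ipvE//.
case: hu hv hw => [[u1 _] [u2 _]] [[v1 _] [v2 _]] [[w1 _] [w2 _]].
congr (_ + _); apply: ip_ael => //; [exact: ae_eq_fst|exact: ae_eq_snd].
Qed.

Lemma ipv_cauchy_schwarz u v : inL2v m D u -> inL2v m D v ->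
  `|ipv m D u v| <= L2normv m D u * L2normv m D v.
Proof.
move=> hu hv; apply: discriminant_le; [exact: ipv_ge0..|move=> t].
have htv := inL2vZ t hv; have hw := inL2vB hu htv.
have := ipv_ge0 (fun x => u x - t *: v x).
rewrite ipvBl// ![ipv _ _ _ (fun x => u x - _)]ipvC !ipvBl// ?ipvZl//.
rewrite ![ipv m D _ (fun x => t *: _)]ipvC !ipvZl// [ipv m D v u]ipvC.
congr (_ <= _); ring.
Qed.

End SquareIntegrableVector.

(** * Borel sets and continuous functions in the plane *)

Section Boxes.
Context (R : realType).
Implicit Types (U : set (plane R)) (a b c d : R).

Definition obox a b c d : set (plane R) := `]a, b[%classic `*` `]c, d[%classic.
Definition cbox a b c d : set (plane R) := `[a, b]%classic `*` `[c, d]%classic.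

Lemma measurable_obox a b c d : measurable (obox a b c d : set (mplane R)).
Proof. by apply: measurableX; exact: measurable_itv. Qed.

Lemma measurable_cbox a b c d : measurable (cbox a b c d : set (mplane R)).
Proof. by apply: measurableX; exact: measurable_itv. Qed.

Lemma compact_cbox a b c d : compact (cbox a b c d).
Proof. by apply: compact_setX; exact: segment_compact. Qed.

Lemma leb2X (A B : set (measurableTypeR R)) : measurable A -> measurable B ->
  leb2 R (A `*` B) = (lebesgue_measure A * lebesgue_measure B)%E.
Proof. exact: product_measure1E. Qed.

Lemma leb2_cbox_fin a b c d : (leb2 R (cbox a b c d) < +oo)%E.
Proof.
rewrite leb2X; [|exact: measurable_itv..].
have fin (x y : R) : lebesgue_measure `[x, y]%classic \is a fin_num.
  by rewrite lebesgue_measure_itv /=; case: ifPn.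
by rewrite ltey_eq fin_numM.
Qed.

Lemma obox_cbox a b c d : obox a b c d `<=` cbox a b c d.
Proof.
by move=> z []; rewrite /= !in_itv/= => /andP[/ltW ? /ltW ?] /andP[/ltW ? /ltW ?];
  split; rewrite /= in_itv/=; apply/andP.
Qed.

Lemma open_rat_box U x : open U -> U x -> exists q : rat * rat * (rat * rat),
  obox (ratr q.1.1) (ratr q.1.2) (ratr q.2.1) (ratr q.2.2) x /\
  cbox (ratr q.1.1) (ratr q.1.2) (ratr q.2.1) (ratr q.2.2) `<=` U.
Proof.
move=> oU Ux; have /nbhs_ballP[e /= e0 eU] : nbhs x U by exact: open_nbhs_nbhs.
have pick_rat (y z : R) : y < z -> exists2 q : rat, y < ratr q & ratr q < z.
  by move=> /rat_in_itvoo[q]; rewrite in_itv/= => /andP[? ?]; exists q.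
have [a a1 a2] : exists2 q : rat, x.1 - e < ratr q & ratr q < x.1
  by apply: pick_rat; lra.
have [b b1 b2] : exists2 q : rat, x.1 < ratr q & ratr q < x.1 + e
  by apply: pick_rat; lra.
have [c c1 c2] : exists2 q : rat, x.2 - e < ratr q & ratr q < x.2
  by apply: pick_rat; lra.
have [d d1 d2] : exists2 q : rat, x.2 < ratr q & ratr q < x.2 + e
  by apply: pick_rat; lra.
exists (a, b, (c, d)); split; first by split; rewrite /= in_itv/=; apply/andP.
move=> y [] /=; rewrite !in_itv/= => /andP[? ?] /andP[? ?]; apply: eU.
by split; rewrite /ball/= ltr_norml; apply/andP; split; lra.
Qed.

(** The closed boxes stay inside [U], so that functions supported in one of them
    are admissible test functions on [U]. *)
Lemma open_bigcup_boxes U : open U -> exists F : nat -> (R * R) * (R * R),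
  U = \bigcup_k obox (F k).1.1 (F k).1.2 (F k).2.1 (F k).2.2 /\
  forall k, cbox (F k).1.1 (F k).1.2 (F k).2.1 (F k).2.2 `<=` U.
Proof.
move=> oU.
pose real q : (R * R) * (R * R) :=
  ((ratr q.1.1, ratr q.1.2), (ratr q.2.1, ratr q.2.2)).
pose inside q := cbox (ratr q.1.1) (ratr q.1.2) (ratr q.2.1) (ratr q.2.2) `<=` U.
pose F k := if unpickle k is Some q then
  if pselect (inside q) then real q else ((1, 0), (1, 0)) else ((1, 0), (1, 0)).
have empty : cbox 1 0 1 0 `<=` U.
  by move=> z [] /=; rewrite in_itv/= => /andP[]; lra.
have Fin k : cbox (F k).1.1 (F k).1.2 (F k).2.1 (F k).2.2 `<=` U.
  by rewrite /F; case: unpickle => [q|]//; case: pselect.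
exists F; split=> //; apply/seteqP; split=> [x Ux|x [k _ /obox_cbox/Fin]//].
have [q [xq qU]] := open_rat_box oU Ux.
by exists (pickle q) => //; rewrite /F pickleK; case: pselect.
Qed.

Lemma open_measurable_plane U : open U -> measurable (U : set (mplane R)).
Proof.
move=> /open_bigcup_boxes[F [-> _]].
by apply: bigcupT_measurable => k; exact: measurable_obox.
Qed.

Lemma closed_measurable_plane U : closed U -> measurable (U : set (mplane R)).
Proof.
move=> cU; rewrite -[U]setCK; apply: measurableC.
by apply: open_measurable_plane; exact: closed_openC.
Qed.

Lemma continuous_measurable_plane (f : scalar_field R) (D : set (plane R)) :
  continuous f -> measurable_fun (D : set (mplane R)) f.
Proof.
move=> cf; apply: measurable_funTS.
apply: (measurability _ (RGenOpens.measurableE R)).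
move=> _ [_ [a [b ->]] <-]; rewrite setTI.
apply: open_measurable_plane; apply: open_comp; last exact: interval_open.
by move=> x _; exact: cf.
Qed.

Lemma bounded_set_cbox U : bounded_set U ->
  exists M : R, U `<=` cbox (- M) M (- M) M.
Proof.
move=> [M0 [_ bU]]; have UM := bU (M0 + 1) (ltr_pwDr ltr01 (lexx _)).
exists (M0 + 1) => x /UM /=; rewrite prod_normE ge_max.
rewrite !ler_norml => /andP[/andP[? ?] /andP[? ?]].
by split; rewrite /= in_itv/=; apply/andP.
Qed.

Lemma bounded_leb2_fin U : bounded_set U -> measurable (U : set (mplane R)) ->
  (leb2 R U < +oo)%E.
Proof.
move=> /bounded_set_cbox[M UM] mU; apply: le_lt_trans (leb2_cbox_fin (- M) M (- M) M).
by apply: le_measure => //; rewrite inE//; exact: measurable_cbox.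
Qed.

Lemma continuous_bounded_cbox (f : scalar_field R) a b c d : continuous f ->
  exists K, forall x, cbox a b c d x -> `|f x| <= K.
Proof.
move=> cf; have : compact (f @` cbox a b c d).
  apply: continuous_compact; last exact: compact_cbox.
  exact: continuous_subspaceT.
move=> /compact_bounded[K [_ bf]]; have fK := bf (K + 1) (ltr_pwDr ltr01 (lexx _)).
exists (K + 1) => x bx.
by apply: (fK (f x)); exists x.
Qed.

Lemma bounded_measurable_inL2 U (f : scalar_field R) K : bounded_set U ->
  measurable (U : set (mplane R)) -> measurable_fun (U : set (mplane R)) f ->
  (forall x, U x -> `|f x| <= K) -> inL2 (leb2 R) U f.
Proof.
move=> bU mU mf fK; apply: inL2P => //.
apply: measurable_bounded_integrable => //; [exact: bounded_leb2_fin|..].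
  exact: measurable_funM.
exists (K * K); split; first exact: num_real.
move=> M KM x Ux /=; apply: le_trans (ltW KM).
by rewrite normrM ler_pM// fK.
Qed.

Lemma continuous_inL2 U (f : scalar_field R) : bounded_set U ->
  measurable (U : set (mplane R)) -> continuous f -> inL2 (leb2 R) U f.
Proof.
move=> bU mU cf; have [M UM] := bounded_set_cbox bU.
have [K fK] := continuous_bounded_cbox (- M) M (- M) M cf.
apply: (@bounded_measurable_inL2 _ _ K) => //.
  exact: continuous_measurable_plane.
by move=> x /UM/fK.
Qed.

End Boxes.

(** * Smooth functions *)

Section FlatFunctions.
Context (R : realType).

(** The functions [x^-m exp (- 1 / x)], extended by 0.  Up to linear combinations
    the family is closed under differentiation, which is why all [m] are needed
    to show that the case [m = 0] is smooth. *)
Definition flat (m : nat) (x : R) : R :=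
  if 0 < x then x^-1 ^+ m * expR (- x^-1) else 0.

Lemma flat_ge0 m x : 0 <= flat m x.
Proof.
rewrite /flat; case: ifPn => // x0.
by rewrite mulr_ge0 ?expR_ge0// exprn_ge0// invr_ge0 ltW.
Qed.

(** From [exp y >= y^n / n!] at [y = 1 / x]: all these functions are [O(x)] at 0. *)
Lemma flat_le m x : flat m x <= m.+1`!%:R * `|x|.
Proof.
rewrite /flat; case: ifPn => [x0|_]; last by rewrite mulr_ge0.
rewrite (gtr0_norm x0) expRN ler_pdivrMr ?expR_gt0//.
have xi0 : 0 < x^-1 by rewrite invr_gt0.
have := expR_ge1Dxn m (ltW xi0).
have := ler_wpM2l (ltW x0) => /[apply] /(ler_wpM2l (ler0n R m.+1`!)).
rewrite -mulrA; apply: le_trans; rewrite mulrDr mulrDr.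
rewrite exprS [X in _ + X](_ : _ = x^-1 ^+ m); last first.
  have c0 : m.+1`!%:R != 0 :> R by rewrite pnatr_eq0 -lt0n fact_gt0.
  have xn0 : x != 0 by rewrite gt_eqF.
  by rewrite [x * _]mulrA mulVKf// mulrCA divff// mulr1.
by rewrite lerDr mulr1 mulr_ge0// ltW.
Qed.

Lemma flat_cvg0 m : flat m x @[x --> 0] --> 0.
Proof.
apply: (@squeeze_cvgr _ _ _ _ (cst 0) (fun x => m.+1`!%:R * `|x|)).
- by near=> x; rewrite /= flat_ge0 flat_le.
- exact: cvg_cst.
- rewrite -[X in _ --> X](mulr0 m.+1`!%:R) -[X in _ * X](@normr0 R R).
  by apply: cvgMr; exact: (@norm_continuous _ _ (0 : R)).
Unshelve. all: by end_near. Qed.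

(** At 0 the difference quotient of [flat m] is [flat m.+1]. *)
Global Instance is_derive_flat (m : nat) (x : R) :
  is_derive x (1 : R) (flat m) (flat m.+2 x - m%:R * flat m.+1 x).
Proof.
have [x0|x0|->] := ltgtP x 0.
- have -> : flat m.+2 x - m%:R * flat m.+1 x = 0.
    by rewrite /flat !ifF ?mulr0 ?subrr// ltNge ltW.
  apply: (@near_eq_is_derive _ _ _ (cst (0 : R) : R -> R)).
  near=> y; rewrite /flat ifF//; apply/negbTE; rewrite -leNgt.
  by near: y; exact: lt_le_nbhsl.
- have xn0 : x != 0 by rewrite gt_eqF.
  apply: (@near_eq_is_derive _ _ _ (fun y : R => y^-1 ^+ m * expR (- y^-1))).
    near=> y; rewrite /flat ifT//.
    by near: y; exact: lt_nbhsr.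
  have dV : is_derive x 1 (fun y : R => y^-1) (- x ^- 2).
    have := @derivableV R R id x 1 xn0 (@derivable_id _ _ x 1).
    by move=> d; apply: DeriveDef => //; rewrite deriveV// derive_id -[_ *: _]/(_ * _) mulr1.
  have dE : is_derive x 1 (fun y : R => expR (- y^-1)) (x ^- 2 * expR (- x^-1)).
    have dN := is_deriveN dV.
    have := @is_derive1_comp R expR (fun y : R => - y^-1) x _ _ (is_derive_expR _) dN.
    by rewrite opprK mulrC.
  have dX : is_derive x 1 (fun y : R => y^-1 ^+ m) (m%:R * x^-1 ^+ m.-1 * - x ^- 2).
    by have := is_deriveX m dV; rewrite exprfctE.
  apply: is_derive_eq (is_deriveM dX dE) _.
  rewrite /flat x0 /GRing.scale/=; case: m {dX} => [|m] /=.
    by rewrite !expr0 -exprVn; ring.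
  by rewrite -exprVn !exprS; ring.
- have -> : flat m.+2 0 - m%:R * flat m.+1 0 = 0 by rewrite /flat ltxx mulr0 subrr.
  have h : (fun h => h^-1 *: ((flat m \o shift 0) (h *: (1 : R)) - flat m 0)) @ 0^' --> (0:R).
    rewrite (_ : (fun h => _) = flat m.+1).
      by apply: cvg_trans (flat_cvg0 m.+1); apply: cvg_app; exact: nbhs_dnbhs.
    apply/funext => h /=; rewrite addr0 [h *: 1]mulr1 /flat ltxx subr0.
    by case: ifP; rewrite /GRing.scale/= ?mulr0// => _; rewrite exprS mulrA.
  by apply: DeriveDef; [apply/cvg_ex; exists 0|apply/cvg_lim].
Unshelve. all: by end_near. Qed.

End FlatFunctions.

Section PartialDerivatives.
Context (R : realType).
Implicit Types (f g : scalar_field R) (k m : nat) (u w z : plane R).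

Lemma CkS k f : Ck k.+1 f -> Ck k f.
Proof.
elim: k f => [f [cf _ _ _]|k ih f [cf df h1 h2]]; first exact: cf.
by split; [exact: cf|exact: df|apply: ih h1|apply: ih h2].
Qed.

Lemma Ck_cst k (a : R) : Ck k (cst a : scalar_field R).
Proof.
elim: k a => [|k ih] a; first by move=> x; exact: cvg_cst.
have d0 w : 'D_w (cst a : scalar_field R) = cst 0.
  by apply/funext => x; rewrite derive_cst.
split; first by move=> x; exact: cvg_cst.
- by move=> x; split; exact: derivable_cst.
- by rewrite /d1 d0.
- by rewrite /d2 d0.
Qed.

Lemma CkD k f g : Ck k f -> Ck k g -> Ck k (fun x => f x + g x).
Proof.
elim: k f g => [f g cf cg x|k ih f g [cf df f1 f2] [cg dg g1 g2]].
  by apply: cvgD; [exact: cf|exact: cg].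
split; first by move=> x; apply: cvgD; [exact: cf|exact: cg].
- by move=> x; have [? ?] := df x; have [? ?] := dg x; split; exact: derivableD.
- rewrite (_ : d1 _ = fun x => d1 f x + d1 g x); first exact: ih.
  by apply/funext => x; rewrite /d1 -deriveD//; [case: (df x)|case: (dg x)].
- rewrite (_ : d2 _ = fun x => d2 f x + d2 g x); first exact: ih.
  by apply/funext => x; rewrite /d2 -deriveD//; [case: (df x)|case: (dg x)].
Qed.

Lemma CkM k f g : Ck k f -> Ck k g -> Ck k (fun x => f x * g x).
Proof.
elim: k f g => [f g cf cg x|k ih f g Cf Cg].
  by apply: cvgM; [exact: cf|exact: cg].
have [[cf df f1 f2] [cg dg g1 g2]] := (Cf, Cg).
split; first by move=> x; apply: cvgM; [exact: cf|exact: cg].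
- move=> x; have [a1 a2] := df x; have [b1 b2] := dg x.
  split; [exact: (derivableM a1 b1)|exact: (derivableM a2 b2)].
- rewrite (_ : d1 _ = fun x => f x * d1 g x + g x * d1 f x).
    by apply: CkD; apply: ih; first [exact: f1|exact: g1|exact: CkS].
  apply/funext => x; case: (df x) (dg x) => [a1 _] [b1 _].
  exact: (deriveM a1 b1).
- rewrite (_ : d2 _ = fun x => f x * d2 g x + g x * d2 f x).
    by apply: CkD; apply: ih; first [exact: f2|exact: g2|exact: CkS].
  apply/funext => x; case: (df x) (dg x) => [_ a2] [_ b2].
  exact: (deriveM a2 b2).
Qed.

Lemma dotDr u w z : dot u (w + z) = dot u w + dot u z.
Proof. by rewrite /dot /=; ring. Qed.

Lemma dotZr u (a : R) z : dot u (a *: z) = a * dot u z.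
Proof. by rewrite /dot /= /GRing.scale/=; ring. Qed.

Lemma continuous_dot u : continuous (dot u).
Proof.
move=> x; apply: cvgD; apply: cvgMr; [exact: cvg_fst|exact: cvg_snd].
Qed.

(** Directional derivatives only see the restriction to a line, on which the
    composite is [G] with rescaled argument. *)
Lemma is_derive_comp_affine (G : R -> R) u (v : R) (z w : plane R) (dG : R) :
  is_derive (dot u z + v) 1 G dG ->
  is_derive z w (fun y => G (dot u y + v)) (dot u w * dG).
Proof.
move=> dG1; set a := dot u z + v.
have Gd : differentiable G a by apply/derivable1_diffP.
have Ga : is_derive a (dot u w) G (dot u w * dG).
  apply: DeriveDef; first exact: diff_derivable.
  rewrite deriveE// -[dot u w in LHS]mulr1 -[_ * 1]/(_ *: 1) linearZ/=.
  by rewrite -deriveE// derive_val.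
have E : (fun h : R => h^-1 *: (((fun y => G (dot u y + v)) \o shift z) (h *: w)
            - G (dot u z + v)))
       = (fun h : R => h^-1 *: ((G \o shift a) (h *: dot u w) - G a)).
  apply/funext => h /=; congr (_ *: (G _ - _)).
  by rewrite dotDr dotZr -addrA.
case: Ga => Ga1 Ga2; apply: DeriveDef; first by rewrite /derivable E.
by rewrite -Ga2 /derive E.
Qed.

Lemma continuous_flat m : continuous (@flat R m).
Proof.
move=> x; apply: differentiable_continuous; apply/derivable1_diffP.
exact: ex_derive.
Qed.

Lemma Ck_flat k m u (v : R) : Ck k (fun z => flat m (dot u z + v)).
Proof.
have cont n : continuous (fun z => @flat R n (dot u z + v)).
  move=> x; apply: (@continuous_comp _ _ _ (fun z => dot u z + v)).
    by apply: cvgD; [exact: continuous_dot|exact: cvg_cst].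
  exact: continuous_flat.
elim: k m => [|k ih] m; first exact: cont.
have D w : 'D_w (fun z => @flat R m (dot u z + v)) =
    fun z => dot u w * flat m.+2 (dot u z + v) +
             (- (dot u w * m%:R)) * flat m.+1 (dot u z + v).
  apply/funext => z; have [_ ->] := is_derive_comp_affine w (is_derive_flat m (dot u z + v)).
  by ring.
have CD w : Ck k ('D_w (fun z => @flat R m (dot u z + v))).
  by rewrite D; apply: CkD; apply: CkM; (exact: ih || exact: Ck_cst).
split; [exact: cont| |exact: CD|exact: CD].
have dF w z : derivable (fun z => @flat R m (dot u z + v)) z w.
  by have [] := is_derive_comp_affine w (is_derive_flat m (dot u z + v)).
by move=> z; split; exact: dF.
Qed.

Lemma smooth_cst (a : R) : smooth (cst a : scalar_field R).
Proof. by move=> k; exact: Ck_cst. Qed.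

Lemma smooth_continuous f : smooth f -> continuous f.
Proof. by move=> /(_ 0%N). Qed.

Lemma smooth_d1 f : smooth f -> smooth (d1 f).
Proof. by move=> sf k; case: (sf k.+1). Qed.

Lemma smooth_d2 f : smooth f -> smooth (d2 f).
Proof. by move=> sf k; case: (sf k.+1). Qed.

Lemma smooth_derivable1 f x : smooth f -> derivable f x ((1, 0) : plane R).
Proof. by move=> /(_ 1%N)[_ /(_ x)[]]. Qed.

Lemma smooth_derivable2 f x : smooth f -> derivable f x ((0, 1) : plane R).
Proof. by move=> /(_ 1%N)[_ /(_ x)[]]. Qed.

Lemma smooth_grad f : smooth f -> smoothv (grad f).
Proof. by move=> sf; split; [exact: smooth_d1|exact: smooth_d2]. Qed.

Lemma derive_vanish f (U : set (plane R)) (x w : plane R) : open U -> U x ->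
  (forall y, U y -> f y = 0) -> 'D_w f x = 0.
Proof.
move=> oU Ux f0; rewrite (@near_eq_derive _ _ _ f (cst 0)) ?derive_cst//.
have : nbhs x U by exact: open_nbhs_nbhs.
by apply: filterS => y /f0 ->.
Qed.

Lemma cpt_supp_derive f Om w : cpt_supp Om f -> cpt_supp Om ('D_w f).
Proof.
move=> [K [cK KOm f0]]; exists K; split=> // x Kx.
apply: (@derive_vanish f (~` K)) => //.
by apply: closed_openC; apply: compact_closed => //; exact: norm_hausdorff.
Qed.

Lemma cpt_supp_grad f Om : cpt_supp Om f -> cpt_supp Om (grad f).
Proof.
move=> [K [cK KOm f0]]; exists K; split=> // x Kx.
have oK : open (~` K).
  by apply: closed_openC; apply: compact_closed => //; exact: norm_hausdorff.
by rewrite /grad /d1 /d2 !(@derive_vanish f (~` K)).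
Qed.

End PartialDerivatives.

(** * Symmetry of mixed derivatives *)

Section MixedDerivatives.
Context (R : realType).
Implicit Types (f : scalar_field R) (x y h : R).

Lemma is_derive_slice1 f x y : derivable f (x, y) ((1, 0) : plane R) ->
  is_derive x 1 (fun t => f (t, y)) (d1 f (x, y)).
Proof.
have E : (fun h : R => h^-1 *: (((fun t => f (t, y)) \o shift x) (h *: (1 : R)) - f (x, y)))
  = (fun h : R => h^-1 *: ((f \o shift (x, y)) (h *: ((1, 0) : plane R)) - f (x, y))).
  apply/funext => h /=; congr (_ *: (f _ - _)).
  rewrite -[RHS]/(h *: (1 : R) + x, h *: (0 : R) + y).
  by rewrite [h *: 0]mulr0 add0r.
by move=> df; apply: DeriveDef; [rewrite /derivable E|rewrite /derive E].
Qed.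

Lemma is_derive_slice2 f x y : derivable f (x, y) ((0, 1) : plane R) ->
  is_derive y 1 (fun t => f (x, t)) (d2 f (x, y)).
Proof.
have E : (fun h : R => h^-1 *: (((fun t => f (x, t)) \o shift y) (h *: (1 : R)) - f (x, y)))
  = (fun h : R => h^-1 *: ((f \o shift (x, y)) (h *: ((0, 1) : plane R)) - f (x, y))).
  apply/funext => h /=; congr (_ *: (f _ - _)).
  rewrite -[RHS]/(h *: (0 : R) + x, h *: (1 : R) + y).
  by rewrite [h *: 0]mulr0 add0r.
by move=> df; apply: DeriveDef; [rewrite /derivable E|rewrite /derive E].
Qed.

Lemma MVT_derive (F dF : R -> R) (a b : R) : a < b ->
  (forall t : R, is_derive t (1 : R) F (dF t)) ->
  exists2 c, a < c < b & F b - F a = dF c * (b - a).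
Proof.
move=> ab dF1.
have cF : {within `[a, b], continuous F}.
  apply: continuous_subspaceT => t; apply: differentiable_continuous.
  by apply/derivable1_diffP; have [] := dF1 t.
have [c] := MVT ab (fun t _ => dF1 t) cF.
by rewrite in_itv/= => ? ?; exists c.
Qed.

Lemma second_difference21 f x y h : smooth f -> 0 < h -> exists c : plane R,
  [/\ x < c.1 < x + h, y < c.2 < y + h &
   f (x + h, y + h) - f (x + h, y) - (f (x, y + h) - f (x, y)) = d2 (d1 f) c * h * h].
Proof.
move=> sf h0; have [||c1 c1x E1] := @MVT_derive (fun t => f (t, y + h) - f (t, y))
    (fun t => d1 f (t, y + h) - d1 f (t, y)) x (x + h); first lra.
  move=> t; apply: is_deriveB; apply: is_derive_slice1; exact: smooth_derivable1.
have [||c2 c2y E2] := @MVT_derive (fun t => d1 f (c1, t))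
    (fun t => d2 (d1 f) (c1, t)) y (y + h); first lra.
  move=> t; apply: is_derive_slice2; apply: smooth_derivable2; exact: smooth_d1.
exists (c1, c2); split=> //; rewrite E1 E2.
by congr (_ * _); [congr (_ * _)|]; ring.
Qed.

Lemma second_difference12 f x y h : smooth f -> 0 < h -> exists c : plane R,
  [/\ x < c.1 < x + h, y < c.2 < y + h &
   f (x + h, y + h) - f (x + h, y) - (f (x, y + h) - f (x, y)) = d1 (d2 f) c * h * h].
Proof.
move=> sf h0; have [||c2 c2y E1] := @MVT_derive (fun t => f (x + h, t) - f (x, t))
    (fun t => d2 f (x + h, t) - d2 f (x, t)) y (y + h); first lra.
  move=> t; apply: is_deriveB; apply: is_derive_slice2; exact: smooth_derivable2.
have [||c1 c1x E2] := @MVT_derive (fun t => d2 f (t, c2))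
    (fun t => d1 (d2 f) (t, c2)) x (x + h); first lra.
  move=> t; apply: is_derive_slice1; apply: smooth_derivable1; exact: smooth_d2.
exists (c1, c2); split=> //.
transitivity (f (x + h, y + h) - f (x, y + h) - (f (x + h, y) - f (x, y))); first ring.
by rewrite E1 E2; congr (_ * _); [congr (_ * _)|]; ring.
Qed.

(** Both mixed derivatives are the limit of the same second difference over
    shrinking squares. *)
Lemma mixed_derivatives f : smooth f -> d1 (d2 f) = d2 (d1 f).
Proof.
move=> sf; apply/funext => -[x y].
have c12 : continuous (d1 (d2 f)) by apply/smooth_continuous/smooth_d1/smooth_d2.
have c21 : continuous (d2 (d1 f)) by apply/smooth_continuous/smooth_d2/smooth_d1.
apply/eqP; rewrite -subr_eq0 -normr_le0; apply/ler_addgt0Pl => e e0; rewrite addr0.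
have e2 : 0 < e / 2 by rewrite divr_gt0.
have /cvgrPdist_le/(_ _ e2)/nbhs_ballP[r1 /= r10 B1] := c12 (x, y).
have /cvgrPdist_le/(_ _ e2)/nbhs_ballP[r2 /= r20 B2] := c21 (x, y).
pose h := Num.min r1 r2.
have h0 : 0 < h by rewrite lt_min r10.
have [c [/andP[c1 c2] /andP[c3 c4] Ec]] := second_difference12 x y sf h0.
have [d [/andP[b1 b2] /andP[b3 b4] Ed]] := second_difference21 x y sf h0.
have hr1 : h <= r1 by rewrite ge_min lexx.
have hr2 : h <= r2 by rewrite ge_min lexx orbT.
have /B1 /= h1 : ball (x, y) r1 c.
  by clear -c1 c2 c3 c4 hr1; split; rewrite /ball /= ltr_norml; apply/andP; split; lra.
have /B2 /= h2 : ball (x, y) r2 d.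
  by clear -b1 b2 b3 b4 hr2; split; rewrite /ball /= ltr_norml; apply/andP; split; lra.
move: Ec Ed h1 h2.
move: (d1 (d2 f) (x, y)) (d2 (d1 f) (x, y)) (d1 (d2 f) c) (d2 (d1 f) d).
move=> p q r s -> /(mulIf (lt0r_neq0 h0))/(mulIf (lt0r_neq0 h0)) <- h1 h2.
have -> : p - q = (p - r) - (q - r) by ring.
by rewrite (le_trans (ler_normB _ _))// [e]splitr lerD.
Qed.

Lemma rot_grad f : smooth f -> Defs.rot (grad f) = cst 0.
Proof.
move=> sf; apply/funext => x; rewrite /Defs.rot.
rewrite -[snd \o grad f]/(d2 f) -[fst \o grad f]/(d1 f).
by rewrite mixed_derivatives// subrr.
Qed.

End MixedDerivatives.

(** * Integrals of derivatives *)

Section IntegrationByParts.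
Context (R : realType).
Implicit Types (f F : scalar_field R) (Om : set (plane R)).

Lemma restrict_vanish (T : Type) (g : T -> R) (D : set T) :
  (forall x, ~ D x -> g x = 0) -> (EFin \o g) \_ D = EFin \o g.
Proof.
move=> g0; apply/funext => x; rewrite patchE; case: ifPn => //.
by rewrite notin_setE => /g0 /= ->.
Qed.

Lemma continuous_integrable_supp f a b c d : continuous f ->
  (forall x, ~ cbox a b c d x -> f x = 0) -> (leb2 R).-integrable setT (EFin \o f).
Proof.
move=> cf f0; have [K fK] := continuous_bounded_cbox a b c d cf.
rewrite -(restrict_vanish f0); apply/(integrable_mkcond _ (measurable_cbox a b c d)).
apply: measurable_bounded_integrable.
- exact: measurable_cbox.
- exact: leb2_cbox_fin.
- exact: continuous_measurable_plane.
- exists K; split; first exact: num_real.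
  by move=> M KM x bx; apply: le_trans (ltW KM); exact: fK.
Qed.

Lemma integral_derive_eq0 (F dF : R -> R) (M : R) :
  (forall t : R, is_derive t (1 : R) F (dF t)) -> continuous dF ->
  (forall t, ~ `[- M, M]%classic t -> F t = 0 /\ dF t = 0) ->
  (\int[lebesgue_measure]_t (dF t)%:E = 0)%E.
Proof.
move=> dF1 cdF F0; pose N := `|M| + 1.
have N0 : - N < N by rewrite /N; have := normr_ge0 M; lra.
have out t : t = N \/ t = - N \/ ~ `[- N, N]%classic t -> F t = 0 /\ dF t = 0.
  move=> tN; apply: F0 => /=; rewrite in_itv/= => /andP[t1 t2].
  have := ler_norm M; have := ler_normr (- M) M; move: tN; rewrite /N /= in_itv/=.
  move=> [|[|/negP]]; rewrite ?negb_and -?ltNge; [lra|lra|].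
  by move=> /orP[]; have := normr_ge0 M; lra.
rewrite (_ : (fun t => (dF t)%:E) = (EFin \o dF) \_ `[- N, N]); last first.
  by rewrite restrict_vanish// => t tN; apply: (out t _).2; right; right.
rewrite -integral_mkcond.
have cF t : {for t, continuous F}.
  by apply: differentiable_continuous; apply/derivable1_diffP; have [] := dF1 t.
rewrite (@continuous_FTC2 _ dF F (- N) N)//.
- by rewrite (out N _).1 ?(out (- N) _).1; [rewrite subee|right; left|left].
- exact: continuous_subspaceT.
- split.
  + by move=> t _; have [] := dF1 t.
  + by apply: cvg_at_right_filter; exact: cF.
  + by apply: cvg_at_left_filter; exact: cF.
- by move=> t _; rewrite derive1E; have [] := dF1 t.
Qed.

Lemma continuous_fix1 f y : continuous f -> continuous (fun t : R => f (t, y)).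
Proof.
move=> cf t; apply: (@continuous_comp _ _ _ (fun t : R => (t, y)) f); last exact: cf.
exact: (@cvg_pair R R R (nbhs t) (nbhs t) (nbhs y) _ _ _ (fun s => s) (fun=> y) cvg_id (cvg_cst y)).
Qed.

Lemma continuous_fix2 f x : continuous f -> continuous (fun t : R => f (x, t)).
Proof.
move=> cf t; apply: (@continuous_comp _ _ _ (fun t : R => (x, t)) f); last exact: cf.
exact: (@cvg_pair R R R (nbhs t) (nbhs x) (nbhs t) _ _ _ (fun=> x) (fun s => s) (cvg_cst x) cvg_id).
Qed.

Lemma closed_cbox (a b c d : R) : closed (cbox a b c d).
Proof. by apply: compact_closed; [exact: norm_hausdorff|exact: compact_cbox]. Qed.

Lemma derive_out_cbox F (M : R) w x : (forall x, ~ cbox (- M) M (- M) M x -> F x = 0) ->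
  ~ cbox (- M) M (- M) M x -> 'D_w F x = 0.
Proof.
move=> F0 xM; apply: (@derive_vanish _ F (~` cbox (- M) M (- M) M)) => //.
by apply: closed_openC; exact: closed_cbox.
Qed.

(** Fubini reduces this to one variable: first integrate along the direction of
    the derivative, where the fundamental theorem of calculus applies. *)
Lemma integral_d1_eq0 F (M : R) : (forall z, derivable F z ((1, 0) : plane R)) ->
  continuous (d1 F) -> (forall x, ~ cbox (- M) M (- M) M x -> F x = 0) ->
  \int[leb2 R]_x d1 F x = 0.
Proof.
move=> dF cdF F0; have dF0 := derive_out_cbox _ F0.
have idF := continuous_integrable_supp cdF (dF0 _).
rewrite /Rintegral -(integral21_prod_meas1 idF) integral0_eq//= => y _.
apply: (@integral_derive_eq0 (fun t => F (t, y)) (fun t : R => d1 F (t, y)) M).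
- by move=> t; apply: is_derive_slice1; exact: dF.
- exact: (continuous_fix1 cdF).
- by move=> t tM; split; [apply: F0|apply: dF0] => -[/= /tM].
Qed.

Lemma integral_d2_eq0 F (M : R) : (forall z, derivable F z ((0, 1) : plane R)) ->
  continuous (d2 F) -> (forall x, ~ cbox (- M) M (- M) M x -> F x = 0) ->
  \int[leb2 R]_x d2 F x = 0.
Proof.
move=> dF cdF F0; have dF0 := derive_out_cbox _ F0.
have idF := continuous_integrable_supp cdF (dF0 _).
rewrite /Rintegral -(integral12_prod_meas1 idF) integral0_eq//= => x _.
apply: (@integral_derive_eq0 (fun t => F (x, t)) (fun t : R => d2 F (x, t)) M).
- by move=> t; apply: is_derive_slice2; exact: dF.
- exact: (continuous_fix2 cdF).
- by move=> t tM; split; [apply: F0|apply: dF0] => -[/= _ /tM].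
Qed.

Lemma cpt_supp_cbox (f : scalar_field R) Om : cpt_supp Om f ->
  exists M, forall x, ~ cbox (- M) M (- M) M x -> f x = 0.
Proof.
move=> [K [/compact_bounded/bounded_set_cbox[M KM] _ f0]]; exists M => x xM.
by apply: f0 => /KM.
Qed.

End IntegrationByParts.

(** * The fundamental lemma of the calculus of variations *)

Section Bump.
Context (R : realType).
Implicit Types (a b c d : R) (x : plane R).

Lemma flat0_le1 (t : R) : flat 0 t <= 1.
Proof.
rewrite /flat; case: ifPn => // t0.
by rewrite expr0 mul1r expR_le1 oppr_le0 invr_ge0 ltW.
Qed.

Lemma flat0_scale_cvg1 (t : R) : 0 < t -> flat 0 (n%:R * t) @[n --> \oo] --> (1 : R).
Proof.
move=> t0; have inv0 : (fun n : nat => (n%:R * t)^-1) @ \oo --> (0 : R).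
  rewrite (_ : (fun n : nat => (n%:R * t)^-1) = (fun n => t^-1 * n%:R^-1)); last first.
    by apply/funext => n; rewrite invfM mulrC.
  rewrite -[X in _ --> X](mulr0 t^-1); apply: cvgMr.
  apply/(gtr0_cvgV0 (f := fun n : nat => n%:R : R)); last exact: cvgr_idn.
  by exists 1%N => // n /= n0; rewrite ltr0n.
have : (fun n : nat => expR (- (n%:R * t)^-1)) @ \oo --> (1 : R).
  rewrite -[X in _ --> X]expR0; apply: continuous_cvg; first exact: continuous_expR.
  by rewrite -[X in _ --> X]oppr0; apply: cvgN.
apply: cvg_trans; apply: near_eq_cvg; near=> n.
rewrite /flat expr0 mul1r ifT// mulr_gt0// ltr0n.
by near: n; exact: nbhs_infty_gt.
Unshelve. all: by end_near. Qed.

Lemma flat0_le0 (t : R) : t <= 0 -> flat 0 t = 0 :> R.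
Proof. by move=> t0; rewrite /flat ltNge t0. Qed.

(** As [n] grows these increase to the indicator function of the open box: each
    of the four factors is [exp (- 1 / (n t))], with [t] the distance to one of
    the sides. *)
Definition box_bump a b c d (n : nat) : scalar_field R := fun z =>
  flat 0 (dot (n%:R, 0) z + - (n%:R * a)) * flat 0 (dot (- n%:R, 0) z + n%:R * b) *
  (flat 0 (dot (0, n%:R) z + - (n%:R * c)) * flat 0 (dot (0, - n%:R) z + n%:R * d)).

Lemma smooth_box_bump a b c d n : smooth (box_bump a b c d n).
Proof. by move=> k; apply: CkM; apply: CkM; exact: Ck_flat. Qed.

Lemma box_bumpE a b c d n x : box_bump a b c d n x =
  flat 0 (n%:R * (x.1 - a)) * flat 0 (n%:R * (b - x.1)) *
  (flat 0 (n%:R * (x.2 - c)) * flat 0 (n%:R * (d - x.2))).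
Proof.
by rewrite /box_bump /dot /=; congr (flat 0 _ * flat 0 _ * (flat 0 _ * flat 0 _)); ring.
Qed.

Lemma box_bump_out a b c d n x : ~ obox a b c d x -> box_bump a b c d n x = 0.
Proof.
move=> xB; rewrite box_bumpE.
have lin (t : R) : t <= 0 -> flat 0 (n%:R * t) = 0 :> R.
  by move=> t0; rewrite flat0_le0// mulr_ge0_le0.
have [h|h1] := leP x.1 a; first by rewrite (lin (x.1 - a)) ?mul0r// subr_le0.
have [h|h2] := leP b x.1; first by rewrite (lin (b - x.1)) ?mulr0 ?mul0r// subr_le0.
have [h|h3] := leP x.2 c; first by rewrite (lin (x.2 - c)) ?mul0r ?mulr0// subr_le0.
have [h|h4] := leP d x.2; first by rewrite (lin (d - x.2)) ?mulr0// subr_le0.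
by case: xB; split; rewrite /= in_itv/=; apply/andP.
Qed.

Lemma box_bump_cvg a b c d x : obox a b c d x -> box_bump a b c d n x @[n --> \oo] --> (1 : R).
Proof.
move=> [/= + +]; rewrite !in_itv/= => /andP[h1 h2] /andP[h3 h4].
rewrite (_ : (fun n => _) = (fun n : nat =>
  flat 0 (n%:R * (x.1 - a)) * flat 0 (n%:R * (b - x.1)) *
  (flat 0 (n%:R * (x.2 - c)) * flat 0 (n%:R * (d - x.2))))); last first.
  by apply/funext => n; rewrite box_bumpE.
suff : (fun n : nat => flat 0 (n%:R * (x.1 - a)) * flat 0 (n%:R * (b - x.1)) *
  (flat 0 (n%:R * (x.2 - c)) * flat 0 (n%:R * (d - x.2)))) @ \oo --> (1 * 1 * (1 * 1) : R).
  by rewrite !mulr1.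
by apply: cvgM; apply: cvgM; apply: flat0_scale_cvg1; rewrite subr_gt0.
Qed.

Lemma box_bump_le1 a b c d n x : `|box_bump a b c d n x| <= 1.
Proof.
rewrite box_bumpE !normrM !ger0_norm ?flat_ge0//.
have mul_le1 (s t : R) : 0 <= s -> 0 <= t -> s <= 1 -> t <= 1 -> s * t <= 1 by nra.
apply: (mul_le1 _ _); rewrite ?mulr_ge0 ?flat_ge0//.
  by apply: (mul_le1 _ _); rewrite ?flat_ge0 ?flat0_le1.
by apply: (mul_le1 _ _); rewrite ?flat_ge0 ?flat0_le1.
Qed.

Lemma cpt_supp_box_bump a b c d n (U : set (plane R)) : cbox a b c d `<=` U ->
  cpt_supp U (box_bump a b c d n).
Proof.
move=> bU; exists (cbox a b c d); split=> //; first exact: compact_cbox.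
by move=> x xB; apply: box_bump_out => /obox_cbox.
Qed.

End Bump.

Section FundamentalLemma.
Context (R : realType).
Implicit Types (a b c d : R) (U : set (plane R)) (v : scalar_field R).

Lemma inL2_integrable U v : bounded_set U -> measurable (U : set (mplane R)) ->
  inL2 (leb2 R) U v -> (leb2 R).-integrable U (EFin \o v).
Proof.
move=> bU mU hv.
have h1 : inL2 (leb2 R) U (cst 1).
  by apply: continuous_inL2 => // x; exact: cvg_cst.
have := inL2_integrable_mul mU hv h1; apply: eq_integrable => // x _ /=.
by rewrite mulr1.
Qed.

(** Bumps approximate the indicator of the box boundedly and pointwise, so
    dominated convergence turns the hypothesis on smooth functions into one on
    boxes. *)
Lemma integral_box_eq0 U v a b c d : bounded_set U -> measurable (U : set (mplane R)) ->
  inL2 (leb2 R) U v ->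
  (forall phi, smooth phi -> cpt_supp U phi -> ip (leb2 R) U v phi = 0) ->
  cbox a b c d `<=` U -> (\int[leb2 R]_(x in obox a b c d) (v x)%:E = 0)%E.
Proof.
move=> bU mU hv v0 BU.
pose w n (x : mplane R) : \bar R := (v x * box_bump a b c d n x)%:E.
have iv := inL2_integrable bU mU hv.
have cb n : continuous (box_bump a b c d n) := smooth_continuous (smooth_box_bump a b c d n).
have iw n : (leb2 R).-integrable U (w n).
  exact: inL2_integrable_mul hv (continuous_inL2 bU mU (cb n)).
have w0 n : (\int[leb2 R]_(x in U) w n x = 0)%E.
  have := v0 _ (smooth_box_bump a b c d n) (cpt_supp_box_bump _ BU).
  rewrite /ip /Rintegral => w0; rewrite -[LHS]fineK; last exact: integrable_fin_num.
  by congr EFin.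
have mv : measurable_fun (U : set (mplane R)) v by case: hv.
have mB : measurable (obox a b c d : set (mplane R)) by exact: measurable_obox.
have mlim : measurable_fun (U : set (mplane R)) ((EFin \o v) \_ (obox a b c d)).
  apply/(measurable_restrict _ mB mU).
  have mIU := measurable_funS mU (@subIsetl _ U (obox a b c d)).
  by apply: mIU; exact/measurable_EFinP.
have wlim : \forall x \ae leb2 R, U x ->
    w ^~ x @ \oo --> ((EFin \o v) \_ (obox a b c d)) x.
  apply: aeW => x Ux; rewrite patchE; case: ifPn => [|].
    rewrite inE => Bx; apply: cvg_EFin; first by apply: nearW.
    rewrite -[X in _ --> X]mulr1; apply: cvgMr; exact: box_bump_cvg.
  rewrite notin_setE => Bx; apply: cvg_near_cst; apply: nearW => n.
  by rewrite /w box_bump_out// mulr0.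
have wdom : \forall x \ae leb2 R, forall n, U x -> (`|w n x| <= (abse \o (EFin \o v)) x)%E.
  apply: aeW => x n _; rewrite /w /= lee_fin normrM ler_piMr//; exact: box_bump_le1.
have [_ _] := dominated_convergence mU (fun n => measurable_int _ (iw n)) mlim wlim
  (integrable_abse iv) wdom.
rewrite (_ : (fun n => _) = cst 0%E); last by apply/funext => n /=; rewrite w0.
move=> /cvg_lim lim0; rewrite -[obox a b c d](@setIidr _ U); last first.
  exact: subset_trans (@obox_cbox R a b c d) BU.
rewrite integral_mkcondr; transitivity (limn (cst 0%E : nat -> \bar R)).
  by rewrite lim0.
exact: lim_cst.
Qed.

Definition oboxes : set (set (plane R)) :=
  [set B | exists a b c d, B = obox a b c d].

Lemma oboxI a b c d a' b' c' d' : obox a b c d `&` obox a' b' c' d' =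
  obox (Num.max a a') (Num.min b b') (Num.max c c') (Num.min d d').
Proof.
apply/seteqP; split=> x /=.
  move=> [[/= + +] [/= + +]]; rewrite !in_itv/= => /andP[? ?] /andP[? ?] /andP[? ?] /andP[? ?].
  by split; rewrite /= in_itv/= gt_max lt_min; apply/andP; split; apply/andP.
move=> [/= + +]; rewrite !in_itv/= !gt_max !lt_min => /andP[/andP[? ?] /andP[? ?]].
move=> /andP[/andP[? ?] /andP[? ?]].
by split; split; rewrite /= in_itv/=; apply/andP.
Qed.

Lemma cbox_subset a b c d a' b' c' d' :
  cbox (Num.max a a') (Num.min b b') (Num.max c c') (Num.min d d') `<=` cbox a b c d.
Proof.
move=> x [/= + +]; rewrite !in_itv/= !ge_max !le_min => /andP[/andP[? ?] /andP[? ?]].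
move=> /andP[/andP[? ?] /andP[? ?]].
by split; rewrite /= in_itv/=; apply/andP.
Qed.

(** The two coordinates are measurable for the sigma-algebra generated by boxes,
    since strips are countable unions of boxes. *)
Lemma oboxes_generate : @measurable _ (mplane R) = <<s oboxes >>.
Proof.
apply/seteqP; split; last first.
  apply: smallest_sub; first exact: sigma_algebra_measurable.
  by move=> _ [a [b [c [d ->]]]]; exact: measurable_obox.
pose G : set (set (mplane R)) := oboxes; pose T := g_sigma_algebraType G.
have mbox a b c d : measurable (obox a b c d : set T).
  by apply: sub_sigma_algebra; exists a, b, c, d.
have bound (t : R) : exists n : nat, - n%:R < t < n%:R.
  exists (Num.truncn `|t|).+1; rewrite -ltr_norml; exact: truncnS_gt.
have mfst : measurable_fun (setT : set T) (fst : T -> measurableTypeR R).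
  apply: (measurability _ (RGenOpens.measurableE R)).
  move=> _ [_ [a [b ->]] <-]; rewrite setTI.
  rewrite (_ : _ @^-1` _ = \bigcup_n obox a b (- n%:R) n%:R).
    by apply: bigcupT_measurable => n; exact: mbox.
  apply/seteqP; split=> [x /= xab|x [n _ [/= ? _]]//].
  by have [n xn] := bound x.2; exists n => //; split; rewrite /= in_itv.
have msnd : measurable_fun (setT : set T) (snd : T -> measurableTypeR R).
  apply: (measurability _ (RGenOpens.measurableE R)).
  move=> _ [_ [a [b ->]] <-]; rewrite setTI.
  rewrite (_ : _ @^-1` _ = \bigcup_n obox (- n%:R) n%:R a b).
    by apply: bigcupT_measurable => n; exact: mbox.
  apply/seteqP; split=> [x /= xab|x [n _ [/= _ ?]]//].
  by have [n xn] := bound x.1; exists n => //; split; rewrite /= in_itv.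
move=> A mA; have := measurable_fun_pair mfst msnd measurableT mA.
rewrite setTI; congr (_ _); apply/seteqP; split=> x /=; by rewrite -surjective_pairing.
Qed.

(** The fundamental lemma of the calculus of variations.  By Dynkin's lemma the
    integrals over all measurable subsets of a box vanish once those over its
    open subboxes do. *)
Lemma test_functions_ae0 U v : bounded_set U -> open U -> inL2 (leb2 R) U v ->
  (forall phi, smooth phi -> cpt_supp U phi -> ip (leb2 R) U v phi = 0) ->
  ae_eq (leb2 R) U v (cst 0).
Proof.
move=> bU oU hv v0; have mU := open_measurable_plane oU.
have iv := inL2_integrable bU mU hv.
have [F [UE FU]] := open_bigcup_boxes oU.
suff Fae k : ae_eq (leb2 R) (obox (F k).1.1 (F k).1.2 (F k).2.1 (F k).2.2) v (cst 0).
  have := ae_foralln Fae; apply: filterS => x Fx; rewrite UE => -[k _ Bx].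
  exact: Fx Bx.
move: {F UE FU}(F k).1.1 (F k).1.2 (F k).2.1 (F k).2.2 (FU k) => a b c d BU.
set B := obox a b c d.
have mB : measurable (B : set (mplane R)) by exact: measurable_obox.
have BsU : B `<=` U := subset_trans (@obox_cbox R a b c d) BU.
have ivB : (leb2 R).-integrable B (EFin \o v) by exact: integrableS iv.
have int0 E : measurable (E : set (mplane R)) -> (\int[leb2 R]_(x in B `&` E) (v x)%:E = 0)%E.
  rewrite oboxes_generate; move: E; apply: dynkin_induction.
  - exact: oboxes_generate.
  - move=> _ _ [a1 [b1 [c1 [d1 ->]]]] [a2 [b2 [c2 [d2 ->]]]].
    by rewrite oboxI; do 4 eexists.
  - by rewrite setIT; exact: integral_box_eq0 hv v0 BU.
  - move=> _ [a' [b' [c' [d' ->]]]]; rewrite oboxI.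
    apply: integral_box_eq0 hv v0 _ => //.
    by apply: subset_trans BU; exact: cbox_subset.
  - move=> S mS S0.
    have mBS : measurable (B `&` S : set (mplane R)) by exact: measurableI.
    have mBC : measurable (B `&` ~` S : set (mplane R)).
      by apply: measurableI => //; exact: measurableC.
    have BE : (B `&` S) `|` (B `&` ~` S) = B by rewrite -setIUr setUv setIT.
    have := integral_box_eq0 bU mU hv v0 BU; rewrite -/B -[in X in X -> _]BE.
    rewrite integral_setU//.
    + by rewrite S0 add0e.
    + by rewrite BE; exact: measurable_int ivB.
    + by apply/disj_setPS => x [[_ ?] [_ ?]].
  - move=> G mG tG G0; rewrite setI_bigcupr integral_bigcup.
    + by apply: eseries0 => n _ _; exact: G0.
    + exact: trivIset_setIl.
    + by move=> n; exact: measurableI.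
    + rewrite -setI_bigcupr; apply: integrableS ivB => //.
      by apply: measurableI => //; exact: bigcupT_measurable.
have : ae_eq (leb2 R) B (EFin \o v) (cst 0%E).
  apply: integral_ae_eq => //= E EB mE.
  by rewrite integral0 -[E](setIidr EB) int0.
by apply: filterS => x /[apply] /= -[->].
Qed.

End FundamentalLemma.

(** * Weak derivatives *)

Section WeakDerivatives.
Context (R : realType).
Implicit Types (U Om : set (plane R)) (r d phi : scalar_field R)
  (q c psi : vector_field R).
Notation leb := (leb2 R).

Lemma Rintegral_supp U Om (f : scalar_field R) : U `<=` Om ->
  (forall x, ~ U x -> f x = 0) ->
  \int[leb]_(x in Om) f x = \int[leb]_(x in U) f x.
Proof.
move=> UO f0; rewrite -[in RHS](setIidr UO) Rintegral_mkcondr.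
apply: eq_Rintegral => x _; rewrite patchE; case: ifPn => //.
by rewrite notin_setE => /f0.
Qed.

Lemma cpt_supp_out (V : zmodType) U (f : plane R -> V) x : cpt_supp U f ->
  ~ U x -> f x = 0.
Proof. by move=> [K [_ KU f0]] Ux; apply: f0 => /KU. Qed.

Lemma cpt_suppS (V : zmodType) U Om (f : plane R -> V) : U `<=` Om ->
  cpt_supp U f -> cpt_supp Om f.
Proof. by move=> UO [K [cK KU f0]]; exists K; split=> //; exact: subset_trans UO. Qed.

Lemma weak_div_unique Om q d d' : bounded_set Om -> open Om ->
  weak_div Om q d -> weak_div Om q d' -> ae_eq leb Om d d'.
Proof.
move=> bO oO [hd Ed] [hd' Ed']; have mO := open_measurable_plane oO.
have : ae_eq leb Om (fun x => d x - d' x) (cst 0).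
  apply: test_functions_ae0 => //; first exact: inL2B.
  move=> phi sp cp; have hp := continuous_inL2 bO mO (smooth_continuous sp).
  rewrite ipBl//; apply/eqP; rewrite subr_eq0 -eqr_opp.
  by rewrite -(Ed _ sp cp) -(Ed' _ sp cp).
by apply: filterS => x /[apply] /eqP; rewrite subr_eq0 => /eqP.
Qed.

(** Test functions with one zero component separate the two components. *)
Lemma weak_curl_unique Om r c c' : bounded_set Om -> open Om ->
  weak_curl Om r c -> weak_curl Om r c' -> ae_eq leb Om c c'.
Proof.
move=> bO oO [hc Ec] [hc' Ec']; have mO := open_measurable_plane oO.
have [[h1 h2] [h1' h2']] := (hc, hc').
have s0 : smooth (cst 0 : scalar_field R) := smooth_cst 0.
have L2phi phi : smooth phi -> inL2 leb Om phi.
  by move=> /smooth_continuous; exact: continuous_inL2.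
have diff0 : forall psi, smoothv psi -> cpt_supp Om psi ->
    ipv leb Om (fun x => c x - c' x) psi = 0.
  move=> psi sp cp; have hp : inL2v leb Om psi.
    by case: sp => sp1 sp2; split; exact: L2phi.
  by rewrite ipvBl// -Ec// -Ec'// subrr.
have hB := inL2vB mO hc hc'.
have ae1 : ae_eq leb Om (fun x => (c x).1 - (c' x).1) (cst 0).
  apply: test_functions_ae0 => //; first by case: hB.
  move=> phi sp cp; pose psi : vector_field R := fun x => (phi x, 0).
  have cpsi : cpt_supp Om psi.
    by case: cp => K [cK KO p0]; exists K; split=> // x /p0; rewrite /psi => ->.
  have := diff0 psi (conj sp s0) cpsi; rewrite ipvE//; last first.
    by split; [exact: L2phi|exact: L2phi].
  have -> : ip leb Om (snd \o (fun x => c x - c' x)) (snd \o psi) = 0.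
    by rewrite ipC; exact: ip0l.
  by rewrite addr0.
have ae2 : ae_eq leb Om (fun x => (c x).2 - (c' x).2) (cst 0).
  apply: test_functions_ae0 => //; first by case: hB.
  move=> phi sp cp; pose psi : vector_field R := fun x => (0, phi x).
  have cpsi : cpt_supp Om psi.
    by case: cp => K [cK KO p0]; exists K; split=> // x /p0; rewrite /psi => ->.
  have := diff0 psi (conj s0 sp) cpsi; rewrite ipvE//; last first.
    by split; [exact: L2phi|exact: L2phi].
  have -> : ip leb Om (fst \o (fun x => c x - c' x)) (fst \o psi) = 0.
    by rewrite ipC; exact: ip0l.
  by rewrite add0r.
apply: filterS2 ae1 ae2 => x e1 e2 Ox; move: (e1 Ox) (e2 Ox) => /= /eqP.
rewrite subr_eq0 => /eqP h11 /eqP; rewrite subr_eq0 => /eqP h22.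
by rewrite [LHS]surjective_pairing h11 h22 -surjective_pairing.
Qed.

Lemma inL2_subset U Om (f : scalar_field R) : U `<=` Om ->
  measurable (U : set (mplane R)) -> measurable (Om : set (mplane R)) ->
  inL2 leb Om f -> inL2 leb U f.
Proof.
move=> UO mU mO [mf itf]; split; first exact: measurable_funS mf.
apply: le_lt_trans itf; apply: ge0_subset_integral => //.
  by apply/measurable_EFinP; exact: measurable_funX.
by move=> x _; rewrite lee_fin sqr_ge0.
Qed.

Lemma weak_div_subset U Om q d : U `<=` Om -> open U -> open Om ->
  weak_div Om q d -> weak_div U q d.
Proof.
move=> UO oU oO [hd Ed].
have mU := open_measurable_plane oU; have mO := open_measurable_plane oO.
split=> [|phi sp cp]; first exact: inL2_subset hd.
have := Ed _ sp (cpt_suppS UO cp); rewrite /ipv /ip !(Rintegral_supp UO)//.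
  by move=> x Ux; rewrite (cpt_supp_out cp Ux) mulr0.
move=> x Ux; rewrite /dot; have [-> ->] : (grad phi x).1 = 0 /\ (grad phi x).2 = 0.
  by rewrite (cpt_supp_out (cpt_supp_grad cp) Ux).
by rewrite !mulr0 addr0.
Qed.

Lemma weak_curl_subset U Om r c : U `<=` Om -> open U -> open Om ->
  weak_curl Om r c -> weak_curl U r c.
Proof.
move=> UO oU oO [[hc1 hc2] Ec].
have mU := open_measurable_plane oU; have mO := open_measurable_plane oO.
split=> [|psi sp cp]; first by split; [exact: inL2_subset hc1|exact: inL2_subset hc2].
have := Ec _ sp (cpt_suppS UO cp); rewrite /ipv /ip !(Rintegral_supp UO)//.
  move=> x Ux; rewrite /dot; have [-> ->] : (psi x).1 = 0 /\ (psi x).2 = 0.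
    by rewrite (cpt_supp_out cp Ux).
  by rewrite !mulr0 addr0.
move=> x Ux; rewrite /Defs.rot.
have h1 : cpt_supp U (fst \o psi).
  by case: cp => K [cK KU p0]; exists K; split=> // y /p0 /= ->.
have h2 : cpt_supp U (snd \o psi).
  by case: cp => K [cK KU p0]; exists K; split=> // y /p0 /= ->.
have -> : d1 (snd \o psi) x = 0 := cpt_supp_out (cpt_supp_derive _ h2) Ux.
have -> : d2 (fst \o psi) x = 0 := cpt_supp_out (cpt_supp_derive _ h1) Ux.
by rewrite subrr mulr0.
Qed.

Lemma is_derive_affine (a : R) (b z w : plane R) :
  is_derive z w (fun x => a + dot b x) (dot b w).
Proof.
have := @is_derive_comp_affine R id b a z w 1 (is_derive_id _ _).
rewrite mulr1 (_ : (fun y => id _) = (fun x => a + dot b x))//.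
by apply/funext => x; rewrite addrC.
Qed.

Lemma continuous_affine (a : R) (b : plane R) : continuous (fun x => a + dot b x).
Proof. by move=> x; apply: cvgD; [exact: cvg_cst|exact: continuous_dot]. Qed.

(** Integration by parts against a test function, which vanishes near the
    boundary of [U], so that no boundary term appears. *)
Lemma affine_ibp1 U (a : R) (b : plane R) phi : bounded_set U -> open U ->
  smooth phi -> cpt_supp U phi ->
  ip leb U (fun x => a + dot b x) (d1 phi) = - (b.1 * ip leb U (cst 1) phi).
Proof.
move=> bU oU sp cp; have mU := open_measurable_plane oU.
pose l x := a + dot b x.
have cl : continuous l := @continuous_affine a b.
have cphi := smooth_continuous sp; have cd := smooth_continuous (smooth_d1 sp).
have dl z := @is_derive_affine a b z ((1, 0) : plane R).
have dF z := derivableM (@ex_derive _ _ _ _ _ _ _ (dl z)) (@smooth_derivable1 R phi z sp).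
have d1F : d1 (fun x => l x * phi x) = fun x => l x * d1 phi x + phi x * b.1.
  apply/funext => z; rewrite /d1.
  have -> := deriveM (@ex_derive _ _ _ _ _ _ _ (dl z)) (@smooth_derivable1 R phi z sp).
  rewrite (@derive_val _ _ _ _ _ _ _ (dl z)) /dot /= mulr1 mulr0 addr0.
  by [].
have [M phiM] := cpt_supp_cbox cp.
have cdF : continuous (d1 (fun x => l x * phi x)).
  rewrite d1F => x; apply: cvgD; apply: cvgM; [exact: cl|exact: cd|exact: cphi|exact: cvg_cst].
have := @integral_d1_eq0 R (fun x => l x * phi x) M dF cdF.
have F0 x : ~ cbox (- M) M (- M) M x -> l x * phi x = 0.
  by move=> /phiM ->; rewrite mulr0.
move=> /(_ F0); rewrite d1F (Rintegral_supp (U := U))//; last first.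
  move=> x Ux; rewrite (cpt_supp_out cp Ux) mul0r addr0.
  have -> : d1 phi x = 0 := cpt_supp_out (cpt_supp_derive _ cp) Ux.
  by rewrite mulr0.
have L2l := continuous_inL2 bU mU cl; have L2p := continuous_inL2 bU mU cphi.
have L2d := continuous_inL2 bU mU cd.
have L2b : inL2 leb U (cst b.1) by apply: continuous_inL2 => // x; exact: cvg_cst.
rewrite RintegralD//; [|exact: inL2_integrable_mul L2l L2d|exact: inL2_integrable_mul L2p L2b].
move=> /eqP; rewrite addr_eq0 => /eqP; rewrite /ip => ->; congr (- _).
rewrite -RintegralZl//; last first.
  apply: (inL2_integrable_mul mU _ L2p).
  by apply: continuous_inL2 => // x; exact: cvg_cst.
by apply: eq_Rintegral => x _; rewrite mul1r mulrC.
Qed.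

Lemma affine_ibp2 U (a : R) (b : plane R) phi : bounded_set U -> open U ->
  smooth phi -> cpt_supp U phi ->
  ip leb U (fun x => a + dot b x) (d2 phi) = - (b.2 * ip leb U (cst 1) phi).
Proof.
move=> bU oU sp cp; have mU := open_measurable_plane oU.
pose l x := a + dot b x.
have cl : continuous l := @continuous_affine a b.
have cphi := smooth_continuous sp; have cd := smooth_continuous (smooth_d2 sp).
have dl z := @is_derive_affine a b z ((0, 1) : plane R).
have dF z := derivableM (@ex_derive _ _ _ _ _ _ _ (dl z)) (@smooth_derivable2 R phi z sp).
have d2F : d2 (fun x => l x * phi x) = fun x => l x * d2 phi x + phi x * b.2.
  apply/funext => z; rewrite /d2.
  have -> := deriveM (@ex_derive _ _ _ _ _ _ _ (dl z)) (@smooth_derivable2 R phi z sp).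
  rewrite (@derive_val _ _ _ _ _ _ _ (dl z)) /dot /= mulr1 mulr0 add0r.
  by [].
have [M phiM] := cpt_supp_cbox cp.
have cdF : continuous (d2 (fun x => l x * phi x)).
  rewrite d2F => x; apply: cvgD; apply: cvgM; [exact: cl|exact: cd|exact: cphi|exact: cvg_cst].
have := @integral_d2_eq0 R (fun x => l x * phi x) M dF cdF.
have F0 x : ~ cbox (- M) M (- M) M x -> l x * phi x = 0.
  by move=> /phiM ->; rewrite mulr0.
move=> /(_ F0); rewrite d2F (Rintegral_supp (U := U))//; last first.
  move=> x Ux; rewrite (cpt_supp_out cp Ux) mul0r addr0.
  have -> : d2 phi x = 0 := cpt_supp_out (cpt_supp_derive _ cp) Ux.
  by rewrite mulr0.
have L2l := continuous_inL2 bU mU cl; have L2p := continuous_inL2 bU mU cphi.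
have L2d := continuous_inL2 bU mU cd.
have L2b : inL2 leb U (cst b.2) by apply: continuous_inL2 => // x; exact: cvg_cst.
rewrite RintegralD//; [|exact: inL2_integrable_mul L2l L2d|exact: inL2_integrable_mul L2p L2b].
move=> /eqP; rewrite addr_eq0 => /eqP; rewrite /ip => ->; congr (- _).
rewrite -RintegralZl//; last first.
  apply: (inL2_integrable_mul mU _ L2p).
  by apply: continuous_inL2 => // x; exact: cvg_cst.
by apply: eq_Rintegral => x _; rewrite mul1r mulrC.
Qed.

End WeakDerivatives.

Section AffineFields.
Context (R : realType).
Implicit Types (U Om : set (plane R)) (r d phi : scalar_field R)
  (q c psi : vector_field R).
Notation leb := (leb2 R).

Lemma inL2_cst U (k : R) : bounded_set U -> measurable (U : set (mplane R)) ->
  inL2 leb U (cst k).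
Proof. by move=> bU mU; apply: continuous_inL2 => // x; exact: cvg_cst. Qed.

Lemma ip_cst U (k : R) phi : bounded_set U -> measurable (U : set (mplane R)) ->
  inL2 leb U phi -> ip leb U (cst k) phi = k * ip leb U (cst 1) phi.
Proof.
move=> bU mU hp; rewrite -ipZl//; last exact: inL2_cst.
by apply: eq_Rintegral => x _; rewrite mulr1.
Qed.

(** Elementwise, weak derivatives are classical ones; for the fields
    [a + b x] of the Raviart-Thomas element the divergence is constant. *)
Lemma weak_div_affine U q (a : plane R) (b : R) : bounded_set U -> open U ->
  (forall x, U x -> q x = a + b *: x) -> weak_div U q (cst (b *+ 2)).
Proof.
move=> bU oU qE; have mU := open_measurable_plane oU.
split=> [|phi sp cp]; first exact: inL2_cst.
have hp := continuous_inL2 bU mU (smooth_continuous sp).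
have h1 := continuous_inL2 bU mU (smooth_continuous (smooth_d1 sp)).
have h2 := continuous_inL2 bU mU (smooth_continuous (smooth_d2 sp)).
have haff (u : R) (w : plane R) : inL2 leb U (fun x => u + dot w x).
  by apply: continuous_inL2 => //; exact: continuous_affine.
rewrite (ip_cst _ bU mU hp); transitivity
  (ip leb U (fun x => a.1 + dot (b, 0) x) (d1 phi) +
   ip leb U (fun x => a.2 + dot (0, b) x) (d2 phi)).
  rewrite /ip /ipv -RintegralD//; [|exact: inL2_integrable_mul..].
  apply: eq_Rintegral => x /set_mem /qE ->.
  by rewrite /dot /= !mul0r addr0 add0r.
rewrite !affine_ibp1// !affine_ibp2//=; ring.
Qed.

Lemma weak_curl_affine U r (a : R) (b : plane R) : bounded_set U -> open U ->
  (forall x, U x -> r x = a + dot b x) -> weak_curl U r (cst (b.2, - b.1)).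
Proof.
move=> bU oU rE; have mU := open_measurable_plane oU.
split=> [|psi [s1 s2] cp]; first by split; exact: inL2_cst.
have h1 := continuous_inL2 bU mU (smooth_continuous s1).
have h2 := continuous_inL2 bU mU (smooth_continuous s2).
have hd1 := continuous_inL2 bU mU (smooth_continuous (smooth_d1 s2)).
have hd2 := continuous_inL2 bU mU (smooth_continuous (smooth_d2 s1)).
have c1 : cpt_supp U (fst \o psi).
  by case: cp => K [cK KU p0]; exists K; split=> // y /p0 /= ->.
have c2 : cpt_supp U (snd \o psi).
  by case: cp => K [cK KU p0]; exists K; split=> // y /p0 /= ->.
have haff : inL2 leb U (fun x => a + dot b x).
  by apply: continuous_inL2 => //; exact: continuous_affine.
transitivity (ip leb U (fun x => a + dot b x) (d1 (snd \o psi)) -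
              ip leb U (fun x => a + dot b x) (d2 (fst \o psi))).
  rewrite /ip -RintegralB//; [|exact: inL2_integrable_mul..].
  by apply: eq_Rintegral => x /set_mem /rE ->; rewrite -mulrBr.
rewrite affine_ibp1// affine_ibp2// ipvE//; last by split; exact: inL2_cst.
have -> : fst \o cst (b.2, - b.1) = cst b.2 :> scalar_field R by [].
have -> : snd \o cst (b.2, - b.1) = cst (- b.1) :> scalar_field R by [].
by rewrite (ip_cst b.2)// (ip_cst (- b.1))//; ring.
Qed.

Section Domain.
Variables (Om : set (plane R)) (bO : bounded_set Om) (oO : open Om).

Lemma curl_is_weak_curl r : Hcurl Om r -> weak_curl Om r (curl Om r).
Proof. by move=> [_ h]; exact: (xgetPex (cst 0) h). Qed.

Lemma div_is_weak_div q : Hdiv Om q -> weak_div Om q (div Om q).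
Proof. by move=> [_ h]; exact: (xgetPex (cst 0) h). Qed.

Lemma curl_inL2 r : Hcurl Om r -> inL2v leb Om (curl Om r).
Proof. by move=> /curl_is_weak_curl[]. Qed.

Lemma div_inL2 q : Hdiv Om q -> inL2 leb Om (div Om q).
Proof. by move=> /div_is_weak_div[]. Qed.

Let mO := open_measurable_plane oO.

Lemma smoothv_inL2 psi : smoothv psi -> inL2v leb Om psi.
Proof.
by move=> [s1 s2]; split; apply: continuous_inL2 => //; exact: smooth_continuous.
Qed.

Lemma rot_inL2 psi : smoothv psi -> inL2 leb Om (Defs.rot psi).
Proof.
move=> [s1 s2]; apply: (inL2B mO);
  apply: continuous_inL2 => //; apply: smooth_continuous.
- exact: smooth_d1.
- exact: smooth_d2.
Qed.

Lemma weak_curl_sub r r' c c' : inL2 leb Om r -> inL2 leb Om r' ->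
  weak_curl Om r c -> weak_curl Om r' c' ->
  weak_curl Om (fun x => r x - r' x) (fun x => c x - c' x).
Proof.
move=> hr hr' [hc Ec] [hc' Ec']; split=> [|psi sp cp]; first exact: inL2vB.
rewrite ipBl//; last exact: rot_inL2.
by rewrite ipvBl//; [rewrite Ec// Ec'|exact: smoothv_inL2].
Qed.

Lemma weak_div_sub q q' d d' : inL2v leb Om q -> inL2v leb Om q' ->
  weak_div Om q d -> weak_div Om q' d' ->
  weak_div Om (fun x => q x - q' x) (fun x => d x - d' x).
Proof.
move=> hq hq' [hd Ed] [hd' Ed']; split=> [|phi sp cp]; first exact: inL2B.
rewrite ipvBl//; last exact/smoothv_inL2/smooth_grad.
rewrite ipBl//; last by apply: continuous_inL2 => //; exact: smooth_continuous.
by rewrite Ed// Ed'// opprB opprK addrC.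
Qed.

Lemma Hcurl_sub r r' : Hcurl Om r -> Hcurl Om r' -> Hcurl Om (fun x => r x - r' x).
Proof.
move=> h h'; split; first by apply: inL2B => //; [case: h|case: h'].
exists (fun x => curl Om r x - curl Om r' x).
by apply: weak_curl_sub; [case: h|case: h'|exact: curl_is_weak_curl|exact: curl_is_weak_curl].
Qed.

Lemma Hdiv_sub q q' : Hdiv Om q -> Hdiv Om q' -> Hdiv Om (fun x => q x - q' x).
Proof.
move=> h h'; split; first by apply: inL2vB => //; [case: h|case: h'].
exists (fun x => div Om q x - div Om q' x).
by apply: weak_div_sub; [case: h|case: h'|exact: div_is_weak_div|exact: div_is_weak_div].
Qed.

Lemma curl_sub_ae r r' : Hcurl Om r -> Hcurl Om r' ->
  ae_eq leb Om (curl Om (fun x => r x - r' x)) (fun x => curl Om r x - curl Om r' x).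
Proof.
move=> h h'; apply: (weak_curl_unique bO oO); first by apply: curl_is_weak_curl; exact: Hcurl_sub.
by apply: weak_curl_sub; [case: h|case: h'|exact: curl_is_weak_curl|exact: curl_is_weak_curl].
Qed.

Lemma div_sub_ae q q' : Hdiv Om q -> Hdiv Om q' ->
  ae_eq leb Om (div Om (fun x => q x - q' x)) (fun x => div Om q x - div Om q' x).
Proof.
move=> h h'; apply: (weak_div_unique bO oO); first by apply: div_is_weak_div; exact: Hdiv_sub.
by apply: weak_div_sub; [case: h|case: h'|exact: div_is_weak_div|exact: div_is_weak_div].
Qed.

Lemma weak_curl0 : weak_curl Om (cst 0) (cst 0).
Proof. by split=> [|psi _ _]; [exact: inL2v_cst0|rewrite (ip0l leb mO) (ipv0l leb mO)]. Qed.

Lemma weak_div0 : weak_div Om (cst 0) (cst 0).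
Proof. by split=> [|psi _ _]; [exact: inL2_cst0|rewrite (ip0l leb mO) (ipv0l leb mO) oppr0]. Qed.

Lemma Hcurl0 : Hcurl Om (cst 0).
Proof. by split; [exact: inL2_cst0|exists (cst 0); exact: weak_curl0]. Qed.

Lemma Hdiv0 : Hdiv Om (cst 0).
Proof. by split; [exact: inL2v_cst0|exists (cst 0); exact: weak_div0]. Qed.

Lemma curl_cst0_ae : ae_eq leb Om (curl Om (cst 0)) (cst 0).
Proof. exact: (weak_curl_unique bO oO (curl_is_weak_curl Hcurl0) weak_curl0). Qed.

Lemma div_cst0_ae : ae_eq leb Om (div Om (cst 0)) (cst 0).
Proof. exact: (weak_div_unique bO oO (div_is_weak_div Hdiv0) weak_div0). Qed.

Variable Gp : set (plane R).

Lemma green_curl_sub r r' psi : Hcurl Om r -> Hcurl Om r' -> smoothv psi ->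
  green_curl Om (fun x => r x - r' x) psi = green_curl Om r psi - green_curl Om r' psi.
Proof.
move=> h h' sp; rewrite /green_curl.
have hcB : inL2v leb Om (fun x => curl Om r x - curl Om r' x).
  by apply: inL2vB => //; exact: curl_inL2.
rewrite (ipv_ael mO _ hcB (smoothv_inL2 sp) (curl_sub_ae h h')); last exact/curl_inL2/Hcurl_sub.
rewrite ipBl//; [|by case: h|by case: h'|exact: rot_inL2].
rewrite ipvBl//; [|exact: curl_inL2|exact: curl_inL2|exact: smoothv_inL2].
by rewrite !opprD addrACA.
Qed.

Lemma green_div_sub q q' phi : Hdiv Om q -> Hdiv Om q' -> smooth phi ->
  green_div Om (fun x => q x - q' x) phi = green_div Om q phi - green_div Om q' phi.
Proof.
move=> h h' sp; rewrite /green_div.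
have hdB : inL2 leb Om (fun x => div Om q x - div Om q' x).
  by apply: inL2B => //; exact: div_inL2.
have hp : inL2 leb Om phi by apply: continuous_inL2 => //; exact: smooth_continuous.
rewrite (ip_ael mO (div_inL2 (Hdiv_sub h h')).1 hdB.1 hp.1 (div_sub_ae h h')).
rewrite ipvBl//; [|by case: h|by case: h'|exact/smoothv_inL2/smooth_grad].
rewrite ipBl//; [|exact: div_inL2|exact: div_inL2].
by rewrite opprD addrACA.
Qed.

Lemma spaceR_sub r r' : spaceR Om Gp r -> spaceR Om Gp r' ->
  spaceR Om Gp (fun x => r x - r' x).
Proof.
move=> [h g] [h' g']; split=> [|psi sp vp]; first exact: Hcurl_sub.
by rewrite green_curl_sub// g// g'// subrr.
Qed.

Lemma spaceQ_sub q q' : spaceQ Om Gp q -> spaceQ Om Gp q' ->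
  spaceQ Om Gp (fun x => q x - q' x).
Proof.
move=> [h g] [h' g']; split=> [|psi sp vp]; first exact: Hdiv_sub.
by rewrite green_div_sub// g// g'// subrr.
Qed.

Lemma spaceR0 : spaceR Om Gp (cst 0).
Proof.
split=> [|psi sp vp]; first exact: Hcurl0.
rewrite /green_curl (ip0l leb mO) (ipv_ael mO _ (@inL2v_cst0 _ _ _) (smoothv_inL2 sp) curl_cst0_ae).
  by rewrite (ipv0l leb mO) subrr.
exact/curl_inL2/Hcurl0.
Qed.

Lemma spaceQ0 : spaceQ Om Gp (cst 0).
Proof.
split=> [|phi sp vp]; first exact: Hdiv0.
have hp : inL2 leb Om phi by apply: continuous_inL2 => //; exact: smooth_continuous.
rewrite /green_div (ipv0l leb mO) (ip_ael mO (div_inL2 Hdiv0).1 _ hp.1 div_cst0_ae); last by case: (@inL2_cst0 R leb Om).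
by rewrite (ip0l leb mO) addr0.
Qed.

(** Test functions [phi] for the divergence become the test functions
    [grad phi] for the curl.  Their rotation vanishes, and [grad phi] vanishes
    near [Gp] when [phi] does, so both the equation [div c = 0] and the boundary
    condition for [c] are inherited from [r].  Here [c] is any representative of
    the curl; the one selected by [curl] need not be elementwise constant
    everywhere. *)
Lemma spaceQ_curl r c : spaceR Om Gp r -> ae_eq leb Om (curl Om r) c ->
  inL2v leb Om c -> spaceQ Om Gp c /\ weak_div Om c (cst 0).
Proof.
move=> [h g] rc hc.
have cgrad phi : smooth phi -> ipv leb Om c (grad phi) = ipv leb Om (curl Om r) (grad phi).
  move=> sp; apply/esym; apply: (ipv_ael mO) => //; first exact: curl_inL2.
  exact/smoothv_inL2/smooth_grad.
have rg phi : smooth phi -> ip leb Om r (Defs.rot (grad phi)) = 0.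
  by move=> sp; rewrite rot_grad// ipC (ip0l leb mO).
have wd : weak_div Om c (cst 0).
  split=> [|phi sp cp]; first exact: inL2_cst0.
  rewrite (ip0l leb mO) oppr0 cgrad//; have [_ <-] := curl_is_weak_curl h; first exact: rg.
    exact: smooth_grad.
  exact: cpt_supp_grad.
have Hd : Hdiv Om c by split=> //; exists (cst 0).
split=> //; split=> // phi sp vp.
have hp : inL2 leb Om phi by apply: continuous_inL2 => //; exact: smooth_continuous.
rewrite /green_div (ip_ael mO (div_inL2 Hd).1 _ hp.1 (weak_div_unique bO oO (div_is_weak_div Hd) wd)).
  rewrite (ip0l leb mO) addr0 cgrad//.
  have := g _ (smooth_grad sp); rewrite /green_curl rg// sub0r.
  move=> /(_ _)/eqP; rewrite oppr_eq0 => /(_ _)/eqP; apply.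
  case: vp => U [oU GU p0]; exists U; split=> // x Ux.
  by rewrite /grad /d1 /d2 !(@derive_vanish _ phi U).
by case: (@inL2_cst0 R leb Om).
Qed.

End Domain.
End AffineFields.

(** * Affine reflections of the plane *)

Section AffineIsometries.
Context (R : realType).
Notation leb := (leb2 R).
Notation lam := (@lebesgue_measure R).
Implicit Types (E : set (mplane R)) (A : set (measurableTypeR R)).

Lemma measurable_fun_shift (c : R) :
  measurable_fun setT (fun y : measurableTypeR R => y + c : measurableTypeR R).
Proof. exact: measurable_funD. Qed.

Lemma lebesgue_measure_shift (c : R) A : measurable A ->
  pushforward lam (fun y : measurableTypeR R => y + c : measurableTypeR R) A = lam A.
Proof.
move=> mA; apply/esym/lebesgue_measure_unique => //= [|_ _ [[a b]] _ <-].
  exact: measurable_fun_shift.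
rewrite /pushforward (_ : _ @^-1` _ = `](a - c), (b - c)]%classic).
  rewrite !lebesgue_measure_itv /= !lte_fin ltrD2r -!EFinB.
  by have -> : b - c - (a - c) = b - a by ring.
by apply/seteqP; split=> y /=; rewrite !in_itv/= ltrBlDr lerBrDr.
Qed.

Lemma lebesgue_measure_reflect (c : R) A : measurable A ->
  lam ((fun y => - y + c) @^-1` A) = lam A.
Proof.
move=> mA; rewrite -[RHS](lebesgue_measure_shift c mA) -[RHS]lebesgue_measureN//.
by rewrite -[X in measurable X]setTI; exact: measurable_fun_shift.
Qed.

Lemma leb2_xsection E : leb E = (\int[lam]_x lam (xsection E x))%E.
Proof. by []. Qed.

Lemma leb2_ysection E : measurable E -> leb E = (\int[lam]_y lam (ysection E y))%E.
Proof.
move=> mE; apply: (@product_measure_unique _ _ _ _ R lam lam (lam \x^ lam)%E) => //.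
by move=> A B mA mB; exact: product_measure2E.
Qed.

Definition leb2_preserving (S : mplane R -> mplane R) :=
  measurable_fun setT S /\ forall E, measurable E -> leb (S @^-1` E) = leb E.

Lemma leb2_preserving_comp S S' : leb2_preserving S -> leb2_preserving S' ->
  leb2_preserving (S \o S').
Proof.
move=> [mS S1] [mS' S'1]; split; first exact: measurableT_comp.
move=> E mE; rewrite comp_preimage S'1 ?S1//.
by rewrite -[X in measurable X]setTI; exact: mS.
Qed.

Let continuous_pair_measurable (f g : scalar_field R) : continuous f -> continuous g ->
  measurable_fun setT (fun x : mplane R => (f x, g x) : mplane R).
Proof.
by move=> cf cg; apply: measurable_fun_pair; exact: continuous_measurable_plane.
Qed.

(** By Fubini an affine map that moves points along one axis only, and is a
    translation or a reflection on each line parallel to that axis, preserves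
    area. *)
Lemma leb2_shear2 (s a b : R) : s = 1 \/ s = -1 ->
  leb2_preserving (fun x => (x.1, s * x.2 + (a * x.1 + b))).
Proof.
move=> s1; have mS : measurable_fun setT (fun x : mplane R =>
    (x.1, s * x.2 + (a * x.1 + b)) : mplane R).
  apply: continuous_pair_measurable => x; first exact: cvg_fst.
  by apply: cvgD; [|apply: cvgD; [|exact: cvg_cst]]; apply: cvgMr;
    [exact: cvg_snd|exact: cvg_fst].
split=> // E mE; rewrite !leb2_xsection; apply: eq_integral => x _.
have mEx := measurable_xsection x mE.
rewrite (_ : xsection _ x = (fun y => s * y + (a * x + b)) @^-1` xsection E x); last first.
  by apply/seteqP; split=> y; rewrite /xsection /= !inE.
case: s1 => ->; last first.
  rewrite -[RHS](lebesgue_measure_reflect (a * x + b) mEx); congr (lam _).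
  by apply/seteqP; split=> y /=; rewrite mulN1r.
rewrite -[RHS](lebesgue_measure_shift (a * x + b) mEx); congr (lam _).
by apply/seteqP; split=> y /=; rewrite mul1r.
Qed.

Lemma leb2_shear1 (s a b : R) : s = 1 \/ s = -1 ->
  leb2_preserving (fun x => (s * x.1 + (a * x.2 + b), x.2)).
Proof.
move=> s1; have mS : measurable_fun setT (fun x : mplane R =>
    (s * x.1 + (a * x.2 + b), x.2) : mplane R).
  apply: continuous_pair_measurable => x; last exact: cvg_snd.
  by apply: cvgD; [|apply: cvgD; [|exact: cvg_cst]]; apply: cvgMr;
    [exact: cvg_fst|exact: cvg_snd].
split=> // E mE; rewrite !leb2_ysection//; last first.
  by rewrite -[X in measurable X]setTI; exact: mS.
apply: eq_integral => y _.
have mEy := measurable_ysection y mE.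
rewrite (_ : ysection _ y = (fun x => s * x + (a * y + b)) @^-1` ysection E y); last first.
  by apply/seteqP; split=> x; rewrite /ysection /= !inE.
case: s1 => ->; last first.
  rewrite -[RHS](lebesgue_measure_reflect (a * y + b) mEy); congr (lam _).
  by apply/seteqP; split=> x /=; rewrite mulN1r.
rewrite -[RHS](lebesgue_measure_shift (a * y + b) mEy); congr (lam _).
by apply/seteqP; split=> x /=; rewrite mul1r.
Qed.

(** The affine reflection in the line [a + b . x = 0] along the direction [d].
    A shear makes [d] parallel to a coordinate axis. *)
Lemma leb2_reflection (a : R) (b d : plane R) : dot b d = 2 ->
  leb2_preserving (fun x => x - (a + dot b x) *: d).
Proof.
case: b d => [b1 b2] [e1 e2]; rewrite /dot /= => bd.
have [e20|e2n0] := eqVneq e2 0.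
  have := @leb2_shear1 (-1) (- (b2 * e1)) (- (a * e1)) (or_intror erefl).
  congr leb2_preserving; apply/funext => -[x y]; rewrite e20 in bd *.
  rewrite -[RHS]/(x - (a + (b1 * x + b2 * y)) * e1, y - (a + (b1 * x + b2 * y)) * 0).
  congr (_, _); last by rewrite mulr0 subr0.
  have b1e1 : b1 * e1 = 2 by rewrite -bd mulr0 addr0.
  transitivity (x - 2 * x - (b2 * e1 * y + a * e1)); first by rewrite /=; ring.
  by rewrite -b1e1; ring.
pose t := e1 / e2.
have h1 := @leb2_shear1 1 t 0 (or_introl erefl).
have h2 := @leb2_shear2 (-1) (- (b1 * e2)) (- (a * e2)) (or_intror erefl).
have h3 := @leb2_shear1 1 (- t) 0 (or_introl erefl).
have := leb2_preserving_comp h1 (leb2_preserving_comp h2 h3).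
congr leb2_preserving; apply/funext => -[x y].
rewrite -[RHS]/(x - (a + (b1 * x + b2 * y)) * e1, y - (a + (b1 * x + b2 * y)) * e2) /=.
have te : t * e2 = e1 by rewrite /t divfK.
have b2e2 : b2 * e2 = 2 - b1 * e1 by rewrite -bd; ring.
have Y : -1 * y + (- (b1 * e2) * (1 * x + (- t * y + 0)) + - (a * e2)) =
    y - (a + (b1 * x + b2 * y)) * e2.
  transitivity (y - (a + b1 * x) * e2 - (2 - b1 * (t * e2)) * y); first ring.
  by rewrite te -b2e2; ring.
rewrite Y; congr (_, _).
rewrite -te; ring.
Qed.

(** A line that is not vertical meets each vertical line in one point, and a
    vertical line is the product of a point with an axis. *)
Lemma leb2_line0 (a : R) (b : plane R) : b != 0 ->
  leb [set x | a + dot b x = 0] = 0%E.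
Proof.
case: b => b1 b2 bn0; have [b20|b2n0] := eqVneq b2 0; last first.
  rewrite leb2_xsection integral0_eq// => x _.
  rewrite (_ : xsection _ x = [set - (a + b1 * x) / b2]); first exact: lebesgue_measure_set1.
  apply/seteqP; split=> y; rewrite /xsection /= inE /dot/=.
    by move=> h; apply: (mulIf b2n0); rewrite divfK//; lra.
  by move=> ->; field.
have b1n0 : b1 != 0 by apply: contraNneq bn0 => b10; rewrite b10 b20.
rewrite (_ : [set x | _] = [set - a / b1] `*` setT); last first.
  apply/seteqP; split=> -[x y]; rewrite /dot /= b20.
    by move=> h; split=> //; apply: (mulIf b1n0); rewrite divfK//; lra.
  by move=> [-> _]; field.
by rewrite leb2X// -[X in (X * _)%E]/(lam [set - a / b1]) lebesgue_measure_set1 mul0e.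
Qed.

End AffineIsometries.

(** * Triangles and the vertex rule *)

Section Triangle.
Context (R : realType).
Notation leb := (leb2 R).
Implicit Types (A B C x : plane R).

Lemma plane_scaleE (t : R) x : t *: x = (t * x.1, t * x.2).
Proof. by []. Qed.

Lemma plane_addE x y : x + y = (x.1 + y.1, x.2 + y.2) :> plane R.
Proof. by []. Qed.

Definition bary_num A B C x : R := cross (B - x) (C - x).
(** The barycentric coordinate of [x] at the vertex [A]; those at [B] and [C] are
    [bary B C A x] and [bary C A B x]. *)
Definition bary A B C x : R := bary_num A B C x / cross (B - A) (C - A).

Lemma cross_cycle A B C : cross (C - B) (A - B) = cross (B - A) (C - A).
Proof. by rewrite /cross /=; ring. Qed.

Definition triangle A B C : set (plane R) :=
  [set x | [/\ 0 <= bary A B C x, 0 <= bary B C A x & 0 <= bary C A B x]].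

Lemma triangle_cycle A B C : triangle A B C = triangle B C A.
Proof. by apply/seteqP; split=> x [h1 h2 h3]. Qed.

Definition bary_slope A B C : plane R :=
  ((B.2 - C.2) / cross (B - A) (C - A), (C.1 - B.1) / cross (B - A) (C - A)).

Lemma bary_affine A B C x :
  bary A B C x = cross B C / cross (B - A) (C - A) + dot (bary_slope A B C) x.
Proof.
rewrite /bary /bary_slope /dot /= -!mulrA ![_^-1 * _]mulrC !mulrA -!mulrDl; congr (_ / _).
by rewrite /bary_num /cross /=; ring.
Qed.

Lemma continuous_bary A B C : continuous (bary A B C).
Proof.
have -> : bary A B C = fun x => cross B C / cross (B - A) (C - A) + dot (bary_slope A B C) x.
  by apply/funext => x; exact: bary_affine.
move=> x; apply: cvgD; first exact: cvg_cst.
by apply: cvgD; apply: cvgMr; [exact: cvg_fst|exact: cvg_snd].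
Qed.

Lemma bary_slope_neq0 A B C : cross (B - A) (C - A) != 0 -> bary_slope A B C != 0.
Proof.
move=> D0; apply: contra_neq (D0) => E.
have /(congr1 ( *%R^~ (cross (B - A) (C - A)))) := congr1 fst E.
rewrite /= divfK// mul0r => /eqP; rewrite subr_eq0 => /eqP h1.
have /(congr1 ( *%R^~ (cross (B - A) (C - A)))) := congr1 snd E.
rewrite /= divfK// mul0r => /eqP; rewrite subr_eq0 => /eqP h2.
rewrite -[cross _ _]/((B.1 - A.1) * (C.2 - A.2) - (B.2 - A.2) * (C.1 - A.1)).
by rewrite h1 h2 mulrC subrr.
Qed.

Section Nondegenerate.
Variables (A B C : plane R).
Hypothesis D0 : cross (B - A) (C - A) != 0.
Let D := cross (B - A) (C - A).
Let D1 : cross (C - B) (A - B) = D. Proof. exact: cross_cycle. Qed.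
Let D2 : cross (A - C) (B - C) = D. Proof. by rewrite cross_cycle D1. Qed.

Lemma bary_sum x : bary A B C x + bary B C A x + bary C A B x = 1.
Proof.
rewrite /bary D1 D2 -!mulrDl -[RHS](divff D0); congr (_ / _).
by rewrite /bary_num /D /cross /=; ring.
Qed.

(** Cramer's rule. *)
Lemma bary_comb x : x = bary A B C x *: A + bary B C A x *: B + bary C A B x *: C.
Proof.
rewrite /bary D1 D2 -/D !plane_scaleE !plane_addE /= ![_ / D * _]mulrAC -!mulrDl.
rewrite [LHS]surjective_pairing; congr (_, _); apply: (mulIf D0); rewrite -/D divfK//;
  by rewrite /bary_num /D /cross /=; ring.
Qed.

Lemma bary_unique (a b c : R) : a + b + c = 1 ->
  let x := a *: A + b *: B + c *: C in
  [/\ bary A B C x = a, bary B C A x = b & bary C A B x = c].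
Proof.
move=> abc; rewrite /= /bary D1 D2 -/D !plane_scaleE.
have -> : a = 1 - b - c by rewrite -abc; ring.
by split; apply: (mulIf D0); rewrite -/D divfK// /bary_num /D /cross /=; ring.
Qed.

Lemma bary_shift x (t : R) : let y := x - t *: (A - B) in
  [/\ bary A B C y = bary A B C x - t, bary B C A y = bary B C A x + t &
      bary C A B y = bary C A B x].
Proof.
rewrite /= /bary D1 D2 -/D plane_scaleE; split; apply: (mulIf D0); rewrite -/D.
- by rewrite [RHS]mulrBl !divfK// /bary_num /D /cross /=; ring.
- by rewrite [RHS]mulrDl !divfK// /bary_num /D /cross /=; ring.
- by rewrite !divfK// /bary_num /D /cross /=; ring.
Qed.

Lemma measurable_triangle : measurable (triangle A B C : set (mplane R)).
Proof.
apply: closed_measurable_plane.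
have cl (X Y Z : plane R) : closed [set x | 0 <= bary X Y Z x].
  rewrite (_ : [set x | _] = bary X Y Z @^-1` `[0, +oo[%classic).
    apply: closed_comp => [x _|]; first exact: continuous_bary.
    exact: interval_closed.
  by apply/seteqP; split=> x /=; rewrite in_itv/= andbT.
rewrite (_ : triangle A B C = [set x | 0 <= bary A B C x] `&`
  ([set x | 0 <= bary B C A x] `&` [set x | 0 <= bary C A B x])).
  by apply: closedI; [|apply: closedI]; exact: cl.
by apply/seteqP; split=> x [h1]; [move=> h2 h3|move=> [h2 h3]].
Qed.

Lemma triangle_in_cbox : exists M : R, triangle A B C `<=` cbox (- M) M (- M) M.
Proof.
exists (`|A.1| + `|B.1| + `|C.1| + (`|A.2| + `|B.2| + `|C.2|)) => x [h1 h2 h3].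
have := bary_comb x; have := bary_sum x; rewrite !plane_scaleE !plane_addE.
move: (bary A B C x) (bary B C A x) (bary C A B x) h1 h2 h3 => a b c a0 b0 c0 abc ->.
have bound (u v w : R) : `|a * u + b * v + c * w| <= `|u| + `|v| + `|w|.
  have le1 (k z : R) : 0 <= k -> k <= 1 -> `|k * z| <= `|z|.
    by move=> k0 k1; rewrite normrM ger0_norm// ler_piMl.
  rewrite (le_trans (ler_normD _ _))// lerD//; last by apply: le1 => //; lra.
  by rewrite (le_trans (ler_normD _ _))// lerD//; apply: le1 => //; lra.
have := bound A.1 B.1 C.1; have := bound A.2 B.2 C.2; rewrite !ler_norml.
have : 0 <= `|A.1| + `|B.1| + `|C.1| by rewrite !addr_ge0.
have : 0 <= `|A.2| + `|B.2| + `|C.2| by rewrite !addr_ge0.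
move: (`|A.1| + `|B.1| + `|C.1|) (`|A.2| + `|B.2| + `|C.2|) => u v v0 u0.
move=> /andP[h1 h2] /andP[h3 h4].
by split; rewrite /= in_itv/=; apply/andP; split; lra.
Qed.

Lemma bounded_triangle : bounded_set (triangle A B C).
Proof.
have [M TM] := triangle_in_cbox; exists M; split; first exact: num_real.
move=> K MK x /TM[/= + +]; rewrite !in_itv/= => /andP[h1 h2] /andP[h3 h4].
by rewrite prod_normE ge_max !ler_norml; apply/andP; split; apply/andP; split; lra.
Qed.

(** The sides of the triangle are contained in three lines. *)
Lemma triangle_boundary_null : leb.-negligible (triangle A B C `\` (triangle A B C)°).
Proof.
pose L (X Y Z : plane R) : set (mplane R) := [set x | bary X Y Z x = 0].
have LE X Y Z : L X Y Z = [set x | cross Y Z / cross (Y - X) (Z - X) + dot (bary_slope X Y Z) x = 0].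
  by apply/seteqP; split=> x; rewrite /L /= bary_affine.
have mL X Y Z : measurable (L X Y Z).
  apply: closed_measurable_plane.
  rewrite (_ : L X Y Z = bary X Y Z @^-1` [set 0])//.
  by apply: closed_comp => [x _|]; [exact: continuous_bary|exact: closed_eq].
exists (L A B C `|` (L B C A `|` L C A B)); split.
- by apply: measurableU => //; exact: measurableU.
- apply: null_set_setU => //; first exact: measurableU.
    by rewrite LE; apply: leb2_line0; exact: bary_slope_neq0.
  apply: null_set_setU => //; rewrite LE; apply: leb2_line0; apply: bary_slope_neq0.
    by rewrite D1.
  by rewrite D2.
- move=> x [Tx Tix]; apply: contrapT => /not_orP[/eqP n1 /not_orP[/eqP n2 /eqP n3]].
  apply: Tix; pose P := [set y | 0 < bary A B C y] `&` ([set y | 0 < bary B C A y] `&`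
    [set y | 0 < bary C A B y]).
  have oP : open P.
    have op (X Y Z : plane R) : open [set y | 0 < bary X Y Z y].
      rewrite (_ : [set y | _] = bary X Y Z @^-1` `]0, +oo[%classic).
        apply: open_comp => [y _|]; first exact: continuous_bary.
        exact: interval_open.
      by apply/seteqP; split=> y /=; rewrite in_itv/= andbT.
    by apply: openI; [|apply: openI]; exact: op.
  have : P `<=` triangle A B C by move=> y [/= p1 [/= p2 /= p3]]; split; exact: ltW.
  rewrite (open_subsetE _ oP); apply; case: Tx => t1 t2 t3.
  by split; [|split]; rewrite /= lt_def; apply/andP.
Qed.

Lemma triangle_shift x : let y := x - (bary A B C x - bary B C A x) *: (A - B) in
  [/\ bary A B C y = bary B C A x, bary B C A y = bary A B C x &
      bary C A B y = bary C A B x].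
Proof.
have [h1 h2 h3] := bary_shift x (bary A B C x - bary B C A x).
by rewrite /=; split; [rewrite h1; ring|rewrite h2; ring|exact: h3].
Qed.

Lemma inL2_bary (X Y Z : plane R) : inL2 leb (triangle A B C) (bary X Y Z).
Proof.
apply: continuous_inL2; [exact: bounded_triangle|exact: measurable_triangle|].
exact: continuous_bary.
Qed.

Lemma integrable_bary (X Y Z : plane R) :
  leb.-integrable (triangle A B C) (EFin \o bary X Y Z).
Proof.
apply: inL2_integrable; [exact: bounded_triangle|exact: measurable_triangle|].
exact: inL2_bary.
Qed.

(** The affine reflection exchanging [A] and [B] preserves area and the
    triangle, and exchanges the two barycentric coordinates. *)
Lemma integral_bary_swap :
  \int[leb]_(x in triangle A B C) bary A B C x =
  \int[leb]_(x in triangle A B C) bary B C A x.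
Proof.
pose alpha x := bary A B C x - bary B C A x.
pose S : mplane R -> mplane R := fun x => x - alpha x *: (A - B).
have mT := measurable_triangle.
pose k := cross B C / cross (B - A) (C - A) - cross C A / cross (C - B) (A - B).
have aE : forall x, alpha x = k + dot (bary_slope A B C - bary_slope B C A) x.
  by move=> x; rewrite /alpha /k !bary_affine /dot /=; ring.
have [mS S1] : leb2_preserving S.
  rewrite (_ : S = fun x => x - (k + dot (bary_slope A B C - bary_slope B C A) x) *: (A - B)).
    apply: leb2_reflection; rewrite /bary_slope D1 -/D /dot /=.
    apply: (mulIf D0); rewrite -/D; transitivity
      ((B.2 - C.2 - (C.2 - A.2)) * (A.1 - B.1) + (C.1 - B.1 - (A.1 - C.1)) * (A.2 - B.2)).
      by field.
    by rewrite /D /cross /=; ring.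
  by apply/funext => x; rewrite /S aE.
have eS x : [/\ bary A B C (S x) = bary B C A x, bary B C A (S x) = bary A B C x &
    bary C A B (S x) = bary C A B x] := triangle_shift x.
have ST : S @^-1` triangle A B C = triangle A B C.
  apply/seteqP; split=> x [h1 h2 h3]; have [e1 e2 e3] := eS x.
    by rewrite e1 in h1; rewrite e2 in h2; rewrite e3 in h3; split.
  by split; [rewrite e1|rewrite e2|rewrite e3].
have Sa x : alpha (S x) = - alpha x.
  by rewrite /alpha; have [-> -> _] := eS x; rewrite opprB.
have ia : leb.-integrable (triangle A B C) (EFin \o alpha).
  by have := integrableB mT (integrable_bary A B C) (integrable_bary B C A).
have iaT : leb.-integrable (S @^-1` triangle A B C) ((EFin \o alpha) \o S).
  rewrite ST; have := integrableN ia; apply: eq_integrable => // x _ /=.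
  by rewrite Sa.
have ma : measurable_fun setT (EFin \o alpha).
  apply/measurable_EFinP; apply: (@measurable_funB _ _ _ _ (bary A B C) (bary B C A)).
    by apply: continuous_measurable_plane; exact: continuous_bary.
  by apply: continuous_measurable_plane; exact: continuous_bary.
have key : (\int[leb]_(x in triangle A B C) (alpha x)%:E =
    \int[leb]_(x in triangle A B C) (- alpha x)%:E)%E.
  transitivity (\int[pushforward leb S]_(x in triangle A B C) (EFin \o alpha) x)%E.
    by apply: eq_measure_integral => E mE _; rewrite /= /pushforward S1.
  rewrite (integral_pushforward mS ma iaT mT) ST.
  by apply: eq_integral => x _; rewrite /= Sa.
have a0 : \int[leb]_(x in triangle A B C) alpha x = 0.
  have : \int[leb]_(x in triangle A B C) alpha x =
      \int[leb]_(x in triangle A B C) (-1 * alpha x).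
    by rewrite /Rintegral key; congr fine; apply: eq_integral => x _; rewrite mulN1r.
  by rewrite RintegralZl//; lra.
apply/eqP; rewrite -subr_eq0 -RintegralB//; last exact: integrable_bary.
  by apply/eqP.
exact: integrable_bary.
Qed.

End Nondegenerate.
End Triangle.

Section TriangleQuadrature.
Context (R : realType).
Notation leb := (leb2 R).
Implicit Types (A B C x : plane R).

Lemma dotBr (u x y : plane R) : dot u (x - y) = dot u x - dot u y.
Proof. by rewrite /dot /=; ring. Qed.

Lemma dot_cauchy_schwarz (u v : plane R) : `|dot u v| <= enorm u * enorm v.
Proof.
apply: discriminant_le => [||t].
- by rewrite /dot -!expr2 addr_ge0 ?sqr_ge0.
- by rewrite /dot -!expr2 addr_ge0 ?sqr_ge0.
have : 0 <= dot (u - t *: v) (u - t *: v) by rewrite /dot -!expr2 addr_ge0 ?sqr_ge0.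
by congr (_ <= _); rewrite plane_scaleE /dot /=; ring.
Qed.

Variables (A B C : plane R).
Hypothesis D0 : cross (B - A) (C - A) != 0.
Let T := triangle A B C.
Let mT : measurable (T : set (mplane R)) := measurable_triangle A B C.
Let bT : bounded_set T := bounded_triangle D0.
Let area : R := fine (leb T).
Let iT (f : scalar_field R) : continuous f -> leb.-integrable T (EFin \o f).
Proof. by move=> cf; apply: inL2_integrable => //; exact: continuous_inL2. Qed.

Lemma integral_bary : \int[leb]_(x in T) bary A B C x = area / 3 /\
  \int[leb]_(x in T) bary B C A x = area / 3 /\
  \int[leb]_(x in T) bary C A B x = area / 3.
Proof.
have e1 : \int[leb]_(x in T) bary A B C x = \int[leb]_(x in T) bary B C A x.
  exact: integral_bary_swap.
have e2 : \int[leb]_(x in T) bary B C A x = \int[leb]_(x in T) bary C A B x.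
  have := @integral_bary_swap R B C A; rewrite -triangle_cycle; apply.
  by rewrite cross_cycle.
have : \int[leb]_(x in T) (bary A B C x + bary B C A x + bary C A B x) = area.
  rewrite (@eq_Rintegral _ _ _ _ _ (cst 1)); last by move=> x _; rewrite bary_sum.
  by rewrite Rintegral_cst// mul1r.
have i1 := iT (@continuous_bary R A B C); have i2 := iT (@continuous_bary R B C A).
have i3 := iT (@continuous_bary R C A B).
rewrite RintegralD// ?RintegralD//; last first.
  by have := integrableD mT i1 i2; apply: eq_integrable.
rewrite -e2 -e1; move: (\int[leb]_(x in T) _) => s h.
have -> : s = area / 3 by rewrite -h; field.
by [].
Qed.

(** An affine function is the combination of the barycentric coordinates with its
    values at the vertices. *)
Lemma integral_affine (a : R) (b : plane R) :
  \int[leb]_(x in T) (a + dot b x) =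
  area / 3 * ((a + dot b A) + (a + dot b B) + (a + dot b C)).
Proof.
have i1 := iT (@continuous_bary R A B C); have i2 := iT (@continuous_bary R B C A).
have i3 := iT (@continuous_bary R C A B).
pose k1 := a + dot b A; pose k2 := a + dot b B; pose k3 := a + dot b C.
transitivity (\int[leb]_(x in T) (k1 * bary A B C x + k2 * bary B C A x + k3 * bary C A B x)).
  apply: eq_Rintegral => x _; rewrite [in LHS](bary_comb D0 x) !dotDr !dotZr.
  rewrite -[X in X + _]mulr1 -(bary_sum D0 x) /k1 /k2 /k3; ring.
have [h1 [h2 h3]] := integral_bary.
have j1 := integrableZl mT k1 i1; have j2 := integrableZl mT k2 i2.
have j3 := integrableZl mT k3 i3.
rewrite RintegralD//; last first.
  by have := integrableD mT j1 j2; apply: eq_integrable.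
rewrite RintegralD// !RintegralZl// h1 h2 h3 -/k1 -/k2 -/k3; ring.
Qed.

(** Both the integral and the vertex rule are exact on the product minus its
    purely quadratic part at the centroid, and each maps that part to something
    of size [h^2]. *)
Lemma vertex_rule_error (a a' h : R) (b b' : plane R) :
  let c : plane R := 3%:R^-1 *: (A + B + C) in
  let r x := a + dot b x in let s x := a' + dot b' x in
  (forall x, T x -> enorm (x - c) <= h) ->
  `|\int[leb]_(x in T) (r x * s x) - area / 3 * (r A * s A + r B * s B + r C * s C)|
  <= 2 * h ^+ 2 * (area * (enorm b * enorm b')).
Proof.
move=> c r s hT.
have cE u : dot u c = 3^-1 * (dot u A + dot u B + dot u C) by rewrite dotZr !dotDr.
pose rho x := dot b (x - c); pose sig x := dot b' (x - c).
pose l x := (r c * a' + a * s c - r c * s c) + dot (r c *: b' + s c *: b) x.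
have rsE x : r x * s x = l x + rho x * sig x.
  by rewrite /l /rho /sig /r /s !dotBr {1}/dot /= !plane_scaleE /= /dot /=; ring.
have crho : continuous rho.
  move=> x; rewrite (_ : rho = fun x => dot b x - dot b c); last first.
    by apply/funext => y; rewrite /rho dotBr.
  by apply: cvgB; [exact: continuous_dot|exact: cvg_cst].
have csig : continuous sig.
  move=> x; rewrite (_ : sig = fun x => dot b' x - dot b' c); last first.
    by apply/funext => y; rewrite /sig dotBr.
  by apply: cvgB; [exact: continuous_dot|exact: cvg_cst].
have crs : continuous (fun x => rho x * sig x).
  by move=> x; apply: cvgM; [exact: crho|exact: csig].
have cl : continuous l.
  by move=> x; apply: cvgD; [exact: cvg_cst|exact: continuous_dot].
have area0 : 0 <= area by rewrite fine_ge0.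
have bnd x : T x -> `|rho x * sig x| <= h ^+ 2 * (enorm b * enorm b').
  move=> Tx; rewrite normrM.
  have n0 (u : plane R) : 0 <= enorm u by rewrite sqrtr_ge0.
  have h1 : `|rho x| <= enorm b * h.
    by rewrite (le_trans (dot_cauchy_schwarz _ _))// ler_wpM2l// hT.
  have h2 : `|sig x| <= enorm b' * h.
    by rewrite (le_trans (dot_cauchy_schwarz _ _))// ler_wpM2l// hT.
  rewrite (le_trans (ler_pM _ _ h1 h2))//.
  by rewrite le_eqVlt; apply/orP; left; apply/eqP; ring.
have [TA TB TC] : [/\ T A, T B & T C].
  have u1 := @bary_unique R A B C D0 1 0 0; have u2 := @bary_unique R A B C D0 0 1 0.
  have u3 := @bary_unique R A B C D0 0 0 1.
  rewrite !scale1r !scale0r !addr0 !add0r /= in u1 u2 u3.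
  have [v1 v2 v3] := u1 erefl; have [v4 v5 v6] := u2 erefl.
  have [v7 v8 v9] := u3 erefl.
  by split; split; rewrite ?(v1, v2, v3, v4, v5, v6, v7, v8, v9).
have -> : \int[leb]_(x in T) (r x * s x) = \int[leb]_(x in T) (l x + rho x * sig x).
  by apply: eq_Rintegral => x _; exact: rsE.
rewrite RintegralD//; [|exact: iT|exact: iT].
rewrite integral_affine -/(l A) -/(l B) -/(l C) !rsE.
set I := \int[leb]_(x in T) _.
have -> : area / 3 * (l A + l B + l C) + I - area / 3 *
    (l A + rho A * sig A + (l B + rho B * sig B) + (l C + rho C * sig C)) =
  I - area / 3 * (rho A * sig A + rho B * sig B + rho C * sig C) by ring.
set K := h ^+ 2 * (enorm b * enorm b').
have K0 : 0 <= K := le_trans (normr_ge0 _) (bnd A TA).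
have I1 : `|I| <= area * K.
  rewrite (le_trans (le_normr_Rintegral mT (iT crs)))//.
  rewrite mulrC -Rintegral_cst//; apply: le_Rintegral => //.
    by have := integrable_abse (iT crs); apply: eq_integrable.
  by apply: (iT (f := cst K)) => x; exact: cvg_cst.
have Q1 : `|area / 3 * (rho A * sig A + rho B * sig B + rho C * sig C)| <= area * K.
  rewrite normrM ger0_norm ?divr_ge0// -mulrA ler_wpM2l// mulrC ler_pdivrMr//.
  have := bnd A TA; have := bnd B TB; have := bnd C TC; rewrite -/K.
  have := ler_normD (rho A * sig A + rho B * sig B) (rho C * sig C).
  have := ler_normD (rho A * sig A) (rho B * sig B).
  lra.
rewrite (le_trans (ler_normB _ _))// (le_trans (lerD I1 Q1))// /K.
by rewrite le_eqVlt; apply/orP; left; apply/eqP; ring.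
Qed.

End TriangleQuadrature.

(** * Integration over a mesh *)

Section NegligibleSets.
Context (R : realType).
Notation leb := (leb2 R).

Lemma Rintegral_negligible (A D : set (mplane R)) (f : scalar_field R) :
  A `<=` D -> measurable A -> measurable D -> leb.-negligible (D `\` A) ->
  measurable_fun D f -> \int[leb]_(x in D) f x = \int[leb]_(x in A) f x.
Proof.
move=> AD mA mD nDA mf; rewrite -[in RHS](setIidr AD) Rintegral_mkcondr.
apply: eq_ae_Rintegral => //.
  apply/(measurable_restrict _ mA mD); apply: measurable_funS mf => //.
have [N [mN N0 DAN]] := nDA; exists N; split=> // x /= /not_implyP[Dx fx].
apply: DAN; split=> // Ax; apply: fx; rewrite patchE ifT//; exact/mem_set.
Qed.

End NegligibleSets.

Section Mesh.
Context (R : realType).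
Notation leb := (leb2 R).
Variables (Om : set (plane R)) (bO : bounded_set Om) (oO : open Om).
Variables (T : mesh R) (hT : mesh_of Om T).
Let mO : measurable (Om : set (mplane R)) := open_measurable_plane oO.
Implicit Types (k l : 'I_(ntri T)).

Lemma sum_I3 (V : zmodType) (F : 'I_3 -> V) :
  \sum_(i < 3) F i = F ord0 + F (inord 1) + F (inord 2).
Proof.
rewrite !big_ord_recl big_ord0 addr0 addrA.
by congr (F _ + F _ + F _); apply/val_inj; rewrite /= ?inordK.
Qed.

Let A k := vtx k ord0.
Let B k := vtx k (inord 1).
Let C k := vtx k (inord 2).

Lemma mesh_nondegenerate k : cross (B k - A k) (C k - A k) != 0.
Proof. by case: hT => + _ _ _ _; exact. Qed.

Lemma tri_triangle k : tri k = triangle (A k) (B k) (C k).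
Proof.
have D0 := mesh_nondegenerate k; apply/seteqP; split=> x.
  move=> [w [w0 w1 _ ->]]; rewrite sum_I3 in w1; rewrite sum_I3 -/(A k) -/(B k) -/(C k).
  by have [h1 h2 h3] := bary_unique D0 w1; split; rewrite ?(h1, h2, h3).
move=> [h1 h2 h3].
pose w (i : 'I_3) := if i == ord0 then bary (A k) (B k) (C k) x else
  if i == inord 1 then bary (B k) (C k) (A k) x else bary (C k) (A k) (B k) x.
have w1 : w (inord 1) = bary (B k) (C k) (A k) x by rewrite /w eqxx -val_eqE /= inordK.
have w2 : w (inord 2) = bary (C k) (A k) (B k) x by rewrite /w -!val_eqE /= !inordK.
exists w; split=> [i||i /(_ I)//|].
- by rewrite /w; case: ifP => // _; case: ifP.
- by rewrite sum_I3 w1 w2 /w eqxx bary_sum.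
- by rewrite sum_I3 w1 w2 {1}/w eqxx; exact: bary_comb.
Qed.

Lemma measurable_tri k : measurable (tri k : set (mplane R)).
Proof. by rewrite tri_triangle; exact: measurable_triangle. Qed.

Lemma bounded_tri k : bounded_set (tri k).
Proof. by rewrite tri_triangle; apply: bounded_triangle; exact: mesh_nondegenerate. Qed.

Lemma tri_boundary_null k : leb.-negligible (tri k `\` (tri k)°).
Proof. by rewrite tri_triangle; apply: triangle_boundary_null; exact: mesh_nondegenerate. Qed.

Lemma open_tri k : open (tri k)°. Proof. exact: open_interior. Qed.

Lemma measurable_tri_interior k : measurable ((tri k)° : set (mplane R)).
Proof. by apply: open_measurable_plane; exact: open_tri. Qed.

Lemma tri_interior_sub k : (tri k)° `<=` Om. Proof. by case: hT => _ _ + _ _; exact. Qed.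

Lemma bounded_tri_interior k : bounded_set (tri k)°.
Proof.
have [M [Mr bM]] := bounded_tri k; exists M; split=> // M' MM' x /interior_subset.
exact: bM.
Qed.

Lemma tri_interior_disjoint k l x : (tri k)° x -> (tri l)° x -> k = l.
Proof.
move=> xk xl; apply/eqP; apply: contraPT isT => kl _.
by case: hT => _ _ _ /(_ _ _ kl) e _; suff : set0 x by []; rewrite -e.
Qed.

(** The sides of the triangles are negligible. *)
Lemma mesh_covers_ae : \forall x \ae leb, Om x -> exists k, (tri k)° x.
Proof.
have inside k : \forall x \ae leb, tri k x -> (tri k)° x.
  have [N [mN N0 sN]] := tri_boundary_null k; exists N; split=> //.
  by move=> x /= /not_implyP[? ?]; exact: sN.
have all_inside : \forall x \ae leb, forall k, tri k x -> (tri k)° x.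
  exact: (@filter_forall _ _ _ _ (ae_filter_ringOfSetsType leb) inside).
move: all_inside; apply: (@filterS _ _ (ae_filter_ringOfSetsType leb)) => x tx Ox.
have : closure Om x by exact: subset_closure.
by case: hT => _ -> _ _ _ [k _ /tx]; exists k.
Qed.

Lemma mesh_ae_eq (V : Type) (u v : plane R -> V) :
  (forall k, ae_eq leb (tri k)° u v) -> ae_eq leb Om u v.
Proof.
move=> uv; have all_uv : \forall x \ae leb, forall k, (tri k)° x -> u x = v x.
  exact: (@filter_forall _ _ _ _ (ae_filter_ringOfSetsType leb) uv).
by apply: (@filterS2 _ _ (ae_filter_ringOfSetsType leb) _ _ _ _ all_uv mesh_covers_ae) => x h1 h2 Ox; have [k kx] := h2 Ox; exact: h1 kx.
Qed.

Lemma Rintegral_sum (D : set (mplane R)) (mD : measurable D) (I : Type) (s : seq I)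
    (F : I -> scalar_field R) :
  (forall i, leb.-integrable D (EFin \o F i)) ->
  \int[leb]_(x in D) (\sum_(i <- s) F i x) = \sum_(i <- s) \int[leb]_(x in D) F i x.
Proof.
move=> iF; elim: s => [|i s ih].
  rewrite big_nil -[RHS](mul0r (fine (leb D))) -Rintegral_cst//.
  by apply: eq_Rintegral => x _; rewrite big_nil.
rewrite big_cons -ih -RintegralD//.
  by apply: eq_Rintegral => x _; rewrite big_cons.
have := integrable_sum (mu := leb) mD s (P := xpredT) (fun i _ => iF i).
by apply: eq_integrable => // x _ /=; rewrite sumEFin.
Qed.

Lemma mesh_integral (f : scalar_field R) : leb.-integrable Om (EFin \o f) ->
  \int[leb]_(x in Om) f x = \sum_(k < ntri T) \int[leb]_(x in (tri k)°) f x.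
Proof.
move=> iF; have mf : measurable_fun (Om : set (mplane R)) f.
  by apply/measurable_EFinP; exact: measurable_int iF.
pose F k : scalar_field R := f \_ (tri k)°.
have iFk k : leb.-integrable Om (EFin \o F k).
  rewrite -restrict_EFin; apply/integrable_restrict => //.
    exact: measurable_tri_interior.
  by apply: integrableS iF => //; apply: measurableI => //; exact: measurable_tri_interior.
transitivity (\int[leb]_(x in Om) (\sum_(k < ntri T) F k x)).
  apply: eq_ae_Rintegral => //.
    by apply: measurable_sum => k; apply/measurable_EFinP; exact: measurable_int (iFk k).
  have := mesh_covers_ae; apply: (@filterS _ _ (ae_filter_ringOfSetsType leb)) => x h Ox; have [k kx] := h Ox.
  rewrite (bigD1 k)//= big1 => [|l lk].
    by rewrite addr0 /F patchE ifT//; exact/mem_set.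
  rewrite /F patchE ifF//; apply: contraNF lk => /set_mem lx.
  by rewrite (tri_interior_disjoint kx lx).
rewrite Rintegral_sum//; apply: eq_bigr => k _.
by rewrite -Rintegral_mkcondr setIidr//; exact: tri_interior_sub.
Qed.

Lemma tri_interior_integral k (f : scalar_field R) : continuous f ->
  \int[leb]_(x in (tri k)°) f x = \int[leb]_(x in tri k) f x.
Proof.
move=> cf; apply/esym/Rintegral_negligible.
- exact: interior_subset.
- exact: measurable_tri_interior.
- exact: measurable_tri.
- exact: tri_boundary_null.
- exact: continuous_measurable_plane.
Qed.

(** Elements of [P_h] are constant at every point of an open triangle.  Functions
    that are elementwise constant only almost everywhere, such as [div Om q] for
    a discrete [q], are represented by these. *)
Definition pwc (c : 'I_(ntri T) -> R) : scalar_field R :=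
  fun x => \sum_(k < ntri T) c k * \1_((tri k)°) x.

Lemma pwcE (c : 'I_(ntri T) -> R) k x : (tri k)° x -> pwc c x = c k.
Proof.
move=> kx; rewrite /pwc (bigD1 k)//= big1 => [|l lk].
  by rewrite addr0 indicE mem_set// mulr1.
rewrite indicE memNset ?mulr0// => lx.
by move/eqP: lk; apply; exact: tri_interior_disjoint lx kx.
Qed.

Lemma inL2_pwc c : inL2 leb Om (pwc c).
Proof.
apply: (@bounded_measurable_inL2 _ _ _ (\sum_(k < ntri T) `|c k|)) => //.
  apply: measurable_sum => k; apply: measurable_funM => //.
  exact: measurable_indic (measurable_tri_interior k).
move=> x _; rewrite (le_trans (ler_norm_sum _ _ _))//; apply: ler_sum => k _.
by rewrite normrM ler_piMr// indicE; case: (_ \in _); rewrite ?normr1 ?normr0.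
Qed.

Lemma tri_diamP k x y : tri k x -> tri k y -> enorm (x - y) <= tri_diam k.
Proof.
move=> kx ky; have [M kM] := bounded_set_cbox (bounded_tri k).
have sup_le : (ediam (tri k) <= (Num.sqrt (8 * M ^+ 2))%:E)%E.
  apply: ge_ereal_sup => _ [->|[[y1 y2] [/= k1 k2] <-]].
    by rewrite lee_fin sqrtr_ge0.
  rewrite lee_fin ler_wsqrtr//; move: (kM _ k1) (kM _ k2) => [/= + +] [/= + +].
  rewrite !in_itv/= -!ler_norml => a1 a2 b1 b2; rewrite /dot /=.
  have sq (u v : R) : `|u| <= M -> `|v| <= M -> (u - v) * (u - v) <= 4 * M ^+ 2.
    by rewrite !ler_norml => /andP[? ?] /andP[? ?]; nra.
  by have := sq _ _ a1 b1; have := sq _ _ a2 b2; lra.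
have le_sup : ((enorm (x - y))%:E <= ediam (tri k))%E.
  by apply: ereal_sup_ubound; right; exists (x, y).
rewrite -lee_fin /tri_diam fineK//.
rewrite fin_numE; apply/andP; split.
  by rewrite gt_eqF// (lt_le_trans _ le_sup)// ltNyr.
by rewrite lt_eqF// (le_lt_trans sup_le)// ltry.
Qed.

Lemma tri_diam_le k : tri_diam k <= mesh_size T.
Proof. exact: le_bigmax. Qed.

Lemma mesh_size_ge0 : 0 <= mesh_size T.
Proof. exact: bigmax_ge_id. Qed.

End Mesh.

(** * Curl, divergence and quadrature on the discrete spaces *)

Lemma weighted_cauchy_schwarz (R : realType) (n : nat) (w u v : 'I_n -> R) :
  (forall k, 0 <= w k) ->
  \sum_k w k * (u k * v k) <=
  Num.sqrt (\sum_k w k * u k ^+ 2) * Num.sqrt (\sum_k w k * v k ^+ 2).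
Proof.
move=> w0; apply: le_trans (ler_norm _) _; apply: discriminant_le => [||t].
- by apply: sumr_ge0 => k _; rewrite mulr_ge0 ?sqr_ge0.
- by apply: sumr_ge0 => k _; rewrite mulr_ge0 ?sqr_ge0.
rewrite mulr_sumr -sumrMnl mulr_sumr -sumrB -big_split /=.
apply: sumr_ge0 => k _.
have -> : w k * u k ^+ 2 - t * (w k * (u k * v k)) *+ 2 + t ^+ 2 * (w k * v k ^+ 2) =
  w k * (u k - t * v k) ^+ 2 by ring.
by rewrite mulr_ge0 ?sqr_ge0.
Qed.

Section DiscreteSpaces.
Context (R : realType).
Notation leb := (leb2 R).
Variables (Om : set (plane R)) (bO : bounded_set Om) (oO : open Om).
Variables (T : mesh R) (hT : mesh_of Om T) (Gp : set (plane R)).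
Let mO : measurable (Om : set (mplane R)) := open_measurable_plane oO.

Definition affine_on (r : scalar_field R) (a : 'I_(ntri T) -> R)
  (b : 'I_(ntri T) -> plane R) := forall k x, tri k x -> r x = a k + dot (b k) x.

Lemma Rh_affine r : spaceRh Om Gp T r -> exists a b, affine_on r a b.
Proof.
move=> [_ _ h].
have : forall k : 'I_(ntri T), exists p : R * plane R, forall x, tri k x -> r x = p.1 + dot p.2 x.
  by move=> k; have [a [b ab]] := h k; exists (a, b).
by move=> /choice[f fP]; exists (fun k => (f k).1), (fun k => (f k).2).
Qed.

(** The elementwise curl of an elementwise affine function. *)
Definition pw_curl (b : 'I_(ntri T) -> plane R) : vector_field R :=
  fun x => (pwc (fun k => (b k).2) x, pwc (fun k => - (b k).1) x).

Lemma pw_curlE b k x : (tri k)° x -> pw_curl b x = ((b k).2, - (b k).1).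
Proof. by move=> kx; rewrite /pw_curl !(pwcE hT _ kx). Qed.

Lemma inL2_pw_curl b : inL2v leb Om (pw_curl b).
Proof. by split; exact: inL2_pwc. Qed.

Lemma curl_pw r a b : Hcurl Om r -> affine_on r a b ->
  ae_eq leb Om (curl Om r) (pw_curl b).
Proof.
move=> hr rab; apply: (mesh_ae_eq hT) => k.
have h1 : weak_curl (tri k)° r (curl Om r).
  apply: (weak_curl_subset (Om := Om)) => //; [exact: tri_interior_sub|exact: open_tri|exact: curl_is_weak_curl].
have bk := bounded_tri_interior hT k; have ok := @open_tri R T k.
have h2 : weak_curl (tri k)° r (cst ((b k).2, - (b k).1)).
  by apply: (@weak_curl_affine _ _ _ (a k)) => // x /interior_subset /rab.
have := weak_curl_unique bk ok h1 h2.
apply: (@filterS _ _ (ae_filter_ringOfSetsType leb)) => x h kx.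
by rewrite (pw_curlE _ kx) h.
Qed.

Lemma div_pw q : spaceQh Om Gp T q -> exists c : 'I_(ntri T) -> R, ae_eq leb Om (div Om q) (pwc c).
Proof.
move=> [[hq _] h].
have : forall k : 'I_(ntri T), exists d : R, weak_div (tri k)° q (cst d).
  move=> k; have [a [b ab]] := h k; exists (b *+ 2).
  apply: (@weak_div_affine _ _ _ a) => //; last exact: open_tri.
  exact: (bounded_tri_interior hT).
move=> /choice[c cP]; exists c; apply: (mesh_ae_eq hT) => k.
have h1 : weak_div (tri k)° q (div Om q).
  apply: (weak_div_subset (Om := Om)) => //; [exact: tri_interior_sub|exact: open_tri|exact: div_is_weak_div].
have bk := bounded_tri_interior hT k; have ok := @open_tri R T k.
have := weak_div_unique bk ok h1 (cP k).
apply: (@filterS _ _ (ae_filter_ringOfSetsType leb)) => x e kx.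
by rewrite (pwcE hT _ kx) e.
Qed.

Lemma Ph_pwc (c : 'I_(ntri T) -> R) : spacePh Om T (pwc c).
Proof.
split=> [|k]; first exact: inL2_pwc.
by exists (c k) => x kx; rewrite (pwcE hT _ kx).
Qed.

Lemma Qh_curl r a b : spaceR Om Gp r -> affine_on r a b -> spaceQh Om Gp T (pw_curl b) /\
  ae_eq leb Om (div Om (pw_curl b)) (cst 0).
Proof.
move=> hr rab; have hc := @inL2_pw_curl b.
have [h1 h2] := spaceQ_curl bO oO hr (curl_pw hr.1 rab) hc.
split; last by apply: (weak_div_unique bO oO _ h2); apply: div_is_weak_div; case: h1.
split=> // k; exists ((b k).2, - (b k).1), 0 => x kx.
by rewrite (pw_curlE _ kx) scale0r addr0.
Qed.

Let area (k : 'I_(ntri T)) : R := fine (leb (tri k)).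

Lemma curl_norm r a b : Hcurl Om r -> affine_on r a b ->
  L2normv leb Om (curl Om r) = Num.sqrt (\sum_(k < ntri T) area k * enorm (b k) ^+ 2).
Proof.
move=> hr rab; rewrite /L2normv; congr Num.sqrt.
have hb := @inL2_pw_curl b; have hc := curl_inL2 hr; have rb := curl_pw hr rab.
rewrite (ipv_ael mO hc hb hc rb) ipvC (ipv_ael mO hc hb hb rb).
rewrite /ipv (mesh_integral oO hT); last first.
  have [h1 h2] := hb.
  have := integrableD mO (inL2_integrable_mul mO h1 h1) (inL2_integrable_mul mO h2 h2).
  by apply: eq_integrable.
apply: eq_bigr => k _.
transitivity (\int[leb]_(x in (tri k)°) (enorm (b k) ^+ 2)).
  apply: eq_Rintegral => x /set_mem kx; rewrite (pw_curlE _ kx).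
  rewrite sqr_sqrtr; last by rewrite /dot -!expr2 addr_ge0 ?sqr_ge0.
  by rewrite /dot /=; ring.
rewrite (tri_interior_integral hT k (f := cst (enorm (b k) ^+ 2))); last first.
  by move=> x; exact: cvg_cst.
by rewrite Rintegral_cst; [rewrite mulrC|exact: (measurable_tri hT)].
Qed.

(** By [curl_norm] the norm of the curl is the weighted sum of the squared slopes,
    so the elementwise errors add up by the Cauchy-Schwarz inequality. *)
Lemma quad_error r s : spaceRh Om Gp T r -> spaceRh Om Gp T s ->
  `|ip leb Om r s - quad (fun _ : 'I_(ntri T) => r) (fun _ => s)| <=
  2 * mesh_size T ^+ 2 * (L2normv leb Om (curl Om r) * L2normv leb Om (curl Om s)).
Proof.
move=> hr hs; have [a [b rab]] := Rh_affine hr; have [a' [b' sab]] := Rh_affine hs.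
have [[hr1 _] _ _] := hr; have [[hs1 _] _ _] := hs.
rewrite (curl_norm hr1 rab) (curl_norm hs1 sab).
have area0 k : 0 <= area k by rewrite fine_ge0.
have ws := weighted_cauchy_schwarz (fun k => enorm (b k)) (fun k => enorm (b' k)) area0.
apply: (@le_trans _ _ (2 * mesh_size T ^+ 2 *
    (\sum_(k < ntri T) area k * (enorm (b k) * enorm (b' k))))); last first.
  by rewrite ler_wpM2l// mulr_ge0// sqr_ge0.
rewrite /ip (mesh_integral oO hT); last first.
  by apply: inL2_integrable_mul => //; [case: hr1|case: hs1].
rewrite /quad -sumrB mulr_sumr (le_trans (ler_norm_sum _ _ _))//.
apply: ler_sum => k _; rewrite (sum_I3 (fun i => r (vtx k i) * s (vtx k i))).
pose A := vtx k ord0; pose B := vtx k (inord 1); pose C := vtx k (inord 2).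
have D0 : cross (B - A) (C - A) != 0 := mesh_nondegenerate hT k.
have TE : tri k = triangle A B C := tri_triangle hT k.
have vin (i : 'I_3) : tri k (vtx k i).
  exists (fun j => (j == i)%:R); split=> [j||j /(_ I)//|]; first by rewrite ler0n.
    by rewrite (bigD1 i)//= eqxx big1 ?addr0// => j /negbTE ->.
  rewrite (bigD1 i)//= eqxx scale1r big1 ?addr0// => j /negbTE ->.
  by rewrite scale0r.
rewrite !(rab k _ (vin _)) !(sab k _ (vin _)).
have -> : \int[leb]_(x in (tri k)°) (r x * s x) =
    \int[leb]_(x in tri k) ((a k + dot (b k) x) * (a' k + dot (b' k) x)).
  rewrite -(tri_interior_integral hT k).
    by apply: eq_Rintegral => x /set_mem/interior_subset kx; rewrite (rab k _ kx) (sab k _ kx).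
  by move=> x; apply: cvgM; exact: continuous_affine.
have cin : tri k (3%:R^-1 *: (A + B + C)).
  have third : 3%:R^-1 + 3%:R^-1 + 3%:R^-1 = 1 :> R by field.
  have [u1 u2 u3] := bary_unique D0 third.
  rewrite !scalerDr TE; split; rewrite ?(u1, u2, u3) invr_ge0; exact: ler0n.
have rad : forall x, triangle A B C x -> enorm (x - 3%:R^-1 *: (A + B + C)) <= tri_diam k.
  by move=> x; rewrite -TE => kx; exact: (tri_diamP hT).
have := vertex_rule_error D0 (a k) (a' k) (b k) (b' k) rad.
rewrite -TE => /le_trans; apply.
rewrite ler_wpM2r//; first by rewrite mulr_ge0// mulr_ge0// sqrtr_ge0.
rewrite ler_wpM2l//; apply: lerXn2r; rewrite ?nnegrE; last exact: tri_diam_le.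
  by apply: le_trans (rad (vtx k ord0) _); rewrite ?sqrtr_ge0// -TE; exact: vin.
exact: mesh_size_ge0.
Qed.

End DiscreteSpaces.

(** * The error equations *)

Section ErrorEquations.
Context (R : realType).
Notation leb := (leb2 R).
Variables (Om : set (plane R)) (bO : bounded_set Om) (oO : open Om).
Variables (T : mesh R) (hT : mesh_of Om T) (Gp : set (plane R)).
Let mO : measurable (Om : set (mplane R)) := open_measurable_plane oO.

Lemma Rh_sub r r' : spaceRh Om Gp T r -> spaceRh Om Gp T r' ->
  spaceRh Om Gp T (fun x => r x - r' x).
Proof.
move=> [h c a] [h' c' a']; split=> [||k].
- exact: spaceR_sub.
- by move=> x; apply: cvgB; [exact: c|exact: c'].
- have [u [v uv]] := a k; have [u' [v' uv']] := a' k; exists (u - u'), (v - v').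
  by move=> x kx; rewrite uv// uv'// /dot /=; ring.
Qed.

Lemma Qh_sub q q' : spaceQh Om Gp T q -> spaceQh Om Gp T q' ->
  spaceQh Om Gp T (fun x => q x - q' x).
Proof.
move=> [h a] [h' a']; split=> [|k]; first exact: spaceQ_sub.
have [u [v uv]] := a k; have [u' [v' uv']] := a' k; exists (u - u'), (v - v').
by move=> x kx; rewrite uv// uv'// scalerBl opprD addrACA.
Qed.

Lemma Ph_sub p p' : spacePh Om T p -> spacePh Om T p' ->
  spacePh Om T (fun x => p x - p' x).
Proof.
move=> [h a] [h' a']; split=> [|k]; first exact: inL2B.
by have [u uk] := a k; have [u' uk'] := a' k; exists (u - u') => x kx; rewrite uk// uk'.
Qed.

Lemma Rh0 : spaceRh Om Gp T (cst 0).
Proof.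
split=> [||k]; first exact: spaceR0.
  by move=> x; exact: cvg_cst.
by exists 0, 0 => x _; rewrite /dot /= !mul0r !addr0.
Qed.

Lemma Qh0 : spaceQh Om Gp T (cst 0).
Proof.
split=> [|k]; first exact: spaceQ0.
by exists 0, 0 => x _; rewrite scale0r addr0.
Qed.

Lemma Ph0 : spacePh Om T (cst 0).
Proof. by split=> [|k]; [exact: inL2_cst0|exists 0]. Qed.

Lemma Xh_sub_X : spaceXh Om Gp T `<=` spaceX Om Gp.
Proof. by move=> x [[h1 _ _] [h2 _] [h3 _]]; split. Qed.

Lemma quad0 (r : 'I_(ntri T) -> scalar_field R) : quad r (fun _ => cst 0) = 0.
Proof.
rewrite /quad big1// => k _; rewrite big1 ?mulr0// => i _.
by rewrite mulr0.
Qed.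

Lemma quadZ (a : R) (r s : scalar_field R) :
  quad (fun (_ : 'I_(ntri T)) z => a * r z) (fun _ => s) =
  a * quad (fun (_ : 'I_(ntri T)) => r) (fun _ => s).
Proof.
rewrite /quad mulr_sumr; apply: eq_bigr => k _.
rewrite mulrCA; congr (_ * _); rewrite mulr_sumr.
by apply: eq_bigr => i _; rewrite mulrA.
Qed.

Lemma ipv_null u v : inL2v leb Om u -> inL2v leb Om v -> ipv leb Om u u = 0 ->
  ipv leb Om u v = 0.
Proof.
move=> hu hv u0; apply/eqP; rewrite -normr_le0.
by rewrite (le_trans (ipv_cauchy_schwarz mO hu hv))// /L2normv u0 sqrtr0 mul0r.
Qed.

Lemma ip0r u : ip leb Om u (cst 0) = 0.
Proof. by rewrite ipC ip0l. Qed.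

Lemma ipv0r u : ipv leb Om u (cst 0) = 0.
Proof. by rewrite ipvC ipv0l. Qed.

Lemma ipv_curl0 q : inL2v leb Om q -> ipv leb Om q (curl Om (cst 0)) = 0.
Proof.
move=> hq; have hc := curl_inL2 (Hcurl0 oO).
rewrite ipvC (ipv_ael mO hc (@inL2v_cst0 _ _ _) hq (curl_cst0_ae bO oO)); exact: ipv0l.
Qed.

Lemma ip_div0 p : inL2 leb Om p -> ip leb Om p (div Om (cst 0)) = 0.
Proof.
move=> hp; have hd := div_inL2 (Hdiv0 oO).
rewrite ipC (ip_ael mO hd.1 (@inL2_cst0 R leb Om).1 hp.1 (div_cst0_ae bO oO)); exact: ip0l.
Qed.

Variables (mu : R) (mu_gt0 : 0 < mu).
Variables (r r' : scalar_field R) (q q' : vector_field R) (p p' : scalar_field R).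
Hypotheses (hr : spaceRh Om Gp T r) (hr' : spaceRh Om Gp T r').
Hypotheses (hq : spaceQh Om Gp T q) (hq' : spaceQh Om Gp T q').
Hypotheses (hp : spacePh Om T p) (hp' : spacePh Om T p').
Hypothesis same_rhs : forall y, spaceXh Om Gp T y ->
  B mu Om (r, q, p) y = Bh mu Om T (r', q', p') y.

Let e_r : scalar_field R := fun x => r x - r' x.
Let e_q : vector_field R := fun x => q x - q' x.
Let e_p : scalar_field R := fun x => p x - p' x.
Let he_r : spaceRh Om Gp T e_r := Rh_sub hr hr'.
Let he_q : spaceQh Om Gp T e_q := Qh_sub hq hq'.
Let he_p : spacePh Om T e_p := Ph_sub hp hp'.
Let L2r s : spaceRh Om Gp T s -> inL2 leb Om s. Proof. by move=> [[[]]]. Qed.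
Let L2q s : spaceQh Om Gp T s -> inL2v leb Om s. Proof. by move=> [[[]]]. Qed.
Let L2p s : spacePh Om T s -> inL2 leb Om s. Proof. by move=> []. Qed.
Let Hc s : spaceRh Om Gp T s -> Hcurl Om s. Proof. by move=> [[]]. Qed.
Let Hd s : spaceQh Om Gp T s -> Hdiv Om s. Proof. by move=> [[]]. Qed.
Let L2c s : spaceRh Om Gp T s -> inL2v leb Om (curl Om s).
Proof. by move=> /Hc/curl_inL2. Qed.
Let L2d s : spaceQh Om Gp T s -> inL2 leb Om (div Om s).
Proof. by move=> /Hd/div_inL2. Qed.

Let qd (s t : scalar_field R) := quad (fun _ : 'I_(ntri T) => s) (fun _ => t).

Lemma error_identity s v w : spaceRh Om Gp T s -> spaceQh Om Gp T v -> spacePh Om T w ->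
  mu^-1 * (ip leb Om r s - qd r' s) - ipv leb Om e_q (curl Om s)
  + ipv leb Om (curl Om e_r) v - ip leb Om e_p (div Om v) + ip leb Om (div Om e_q) w = 0.
Proof.
move=> hs hv hw.
have := @same_rhs (s, v, w) (And3 hs hv hw).
rewrite /B /Bh /Bgen /rr /qq /pp /= quadZ -/(qd r' s) (ipZl mO _ (L2r hr) (L2r hs)).
rewrite (ipvBl mO (L2q hq) (L2q hq') (L2c hs)).
rewrite (ipv_ael mO (L2c he_r) (inL2vB mO (L2c hr) (L2c hr')) (L2q hv) (curl_sub_ae bO oO (Hc hr) (Hc hr'))).
rewrite (ipvBl mO (L2c hr) (L2c hr') (L2q hv)).
rewrite (ipBl mO (L2p hp) (L2p hp') (L2d hv)).
rewrite (ip_ael mO (L2d he_q).1 (inL2B mO (L2d hq) (L2d hq')).1 (L2p hw).1 (div_sub_ae bO oO (Hd hq) (Hd hq'))).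
rewrite (ipBl mO (L2d hq) (L2d hq') (L2p hw)).
move: (ip leb Om r s) (qd r' s) (ipv leb Om q _) (ipv leb Om q' _).
move: (ipv leb Om (curl Om r) v) (ipv leb Om (curl Om r') v).
move: (ip leb Om p _) (ip leb Om p' _) (ip leb Om (div Om q) w) (ip leb Om (div Om q') w).
move: mu^-1 => m x1 x2 x3 x4 x5 x6 x7 x8 x9 x10 h; lra.
Qed.

(** Testing with its own curl, which is a divergence free element of the
    discrete space, shows that the error in the vorticity is curl free. *)
Lemma curl_error : ipv leb Om (curl Om e_r) (curl Om e_r) = 0.
Proof.
have [a [b rab]] := Rh_affine he_r.
have [hc dc] := Qh_curl bO oO hT (Gp := Gp) (let: And3 h _ _ := he_r in h) rab.
have := error_identity Rh0 hc Ph0.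
rewrite ip0r /qd quad0 subrr mulr0 ipv_curl0; last exact: L2q.
rewrite ip0r addr0 subr0 add0r.
have -> : ip leb Om e_p (div Om (pw_curl b)) = 0.
  rewrite ipC (ip_ael mO (L2d hc).1 (@inL2_cst0 R leb Om).1 (L2p he_p).1 dc); exact: ip0l.
rewrite subr0 => <-; rewrite [RHS]ipvC.
by apply: (ipv_ael mO (L2c he_r) (L2q hc) (L2c he_r)); exact: (curl_pw oO hT (Hc he_r) rab).
Qed.

Lemma ep_div_orthogonal v : spaceQh Om Gp T v -> ip leb Om e_p (div Om v) = 0.
Proof.
move=> hv; have := error_identity Rh0 hv Ph0.
rewrite ip0r /qd quad0 subrr mulr0 ipv_curl0; last exact: L2q.
rewrite ip0r addr0 subr0 add0r (ipv_null (L2c he_r) (L2q hv) curl_error) sub0r.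
by move=> /eqP; rewrite oppr_eq0 => /eqP.
Qed.

(** The same argument one step further in the complex: [div e_q] agrees almost
    everywhere with an element of [P_h]. *)
Lemma div_error : ip leb Om (div Om e_q) (div Om e_q) = 0.
Proof.
have [c hc] := div_pw oO hT he_q; have hw := Ph_pwc bO oO hT c.
have := error_identity Rh0 Qh0 hw.
rewrite ip0r /qd quad0 subrr mulr0 ipv_curl0; last exact: L2q.
rewrite ipv0r ip_div0; last exact: L2p.
rewrite !subr0 !addr0 add0r ipC => <-.
by apply: (ip_ael mO (L2d he_q).1 (L2p hw).1 (L2d he_q).1).
Qed.

(** A curl free elementwise affine function is elementwise constant, and the
    quadrature is exact on its products with affine functions. *)
Lemma vorticity_error : ip leb Om e_r e_r = 0.
Proof.
have := error_identity he_r Qh0 Ph0.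
rewrite ipv0r ip_div0; last exact: L2p.
rewrite ip0r !subr0 !addr0 ipvC (ipv_null (L2c he_r) (L2q he_q) curl_error) subr0.
move=> /eqP; rewrite mulf_eq0 invr_eq0 gt_eqF//= subr_eq0 => /eqP E.
have := quad_error bO oO hT hr' he_r.
rewrite {2}/L2normv curl_error sqrtr0 !mulr0 normr_le0 subr_eq0 -/(qd r' e_r) => /eqP E'.
by rewrite [LHS](ipBl mO (L2r hr) (L2r hr') (L2r he_r)) E E' subrr.
Qed.

Lemma curl_norm_eq : L2normv leb Om (curl Om r') = L2normv leb Om (curl Om r).
Proof.
have o w : inL2v leb Om w -> ipv leb Om (curl Om r) w = ipv leb Om (curl Om r') w.
  move=> hw; have := ipv_null (L2c he_r) hw curl_error.
  rewrite (ipv_ael mO (L2c he_r) (inL2vB mO (L2c hr) (L2c hr')) hw (curl_sub_ae bO oO (Hc hr) (Hc hr'))).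
  by rewrite (ipvBl mO (L2c hr) (L2c hr') hw) => /eqP; rewrite subr_eq0 => /eqP.
rewrite /L2normv -o; last exact: L2c.
by rewrite ipvC -o//; exact: L2c.
Qed.

(** Subtracting [error_identity] leaves only the quadrature error of [r'] against
    the first component of [y]; and [r'] has the same curl as [r]. *)
Lemma error_residual y : spaceXh Om Gp T y ->
  `|B mu Om (e_r, e_q, e_p) y| <=
  mu^-1 * (2 * mesh_size T ^+ 2 * (L2normv leb Om (curl Om r) * L2normv leb Om (curl Om (rr y)))).
Proof.
case: y => [[s v] w] [hs hv hw]; rewrite /rr /qq /pp /= in hs hv hw *.
have := error_identity hs hv hw; have := quad_error bO oO hT hr' hs.
rewrite curl_norm_eq -/(qd r' s).
rewrite /B /Bgen /rr /qq /pp /= (ipZl mO _ (L2r he_r) (L2r hs)) (ipBl mO (L2r hr) (L2r hr') (L2r hs)).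
move: (ip leb Om r s) (ip leb Om r' s) (qd r' s) (ipv leb Om e_q _) => x1 x2 x3 x4.
move: (ipv leb Om (curl Om e_r) v) (ip leb Om e_p _) (ip leb Om (div Om e_q) w) => x5 x6 x7.
move: (2 * _ * _) => K hK E.
have -> : mu^-1 * (x1 - x2) - x4 + x5 - x6 + x7 = - (mu^-1 * (x2 - x3)) by lra.
by rewrite normrN normrM gtr0_norm ?invr_gt0// ler_wpM2l// invr_ge0 ltW.
Qed.

(** What remains of the second error equation, in the form in which stability
    applies to it. *)
Lemma pressure_residual y : spaceXh Om Gp T y -> B mu Om (cst 0, cst 0, e_p) y = 0.
Proof.
case: y => [[s v] w] [hs hv hw]; rewrite /rr /qq /pp /= in hs hv hw.
rewrite /B /Bgen /rr /qq /pp /= ep_div_orthogonal//.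
rewrite (ipZl mO _ (@inL2_cst0 R leb Om) (L2r hs)) ip0l// ipv0l// mulr0.
rewrite ipvC ipv_curl0; last exact: L2q.
rewrite [ip leb Om (div Om _) _]ipC ip_div0; last exact: L2p.
by rewrite !subr0 !addr0.
Qed.

End ErrorEquations.

Lemma L2norm_ge0 (R : realType) (m : {measure set (mplane R) -> \bar R})
  (D : set (plane R)) (u : scalar_field R) : 0 <= L2norm m D u.
Proof. exact: sqrtr_ge0. Qed.

Lemma L2normv_ge0 (R : realType) (m : {measure set (mplane R) -> \bar R})
  (D : set (plane R)) (u : vector_field R) : 0 <= L2normv m D u.
Proof. exact: sqrtr_ge0. Qed.

Lemma Enorm_ge_curl (R : realType) (Om : set (plane R)) (x : triple R) :
  L2normv (leb2 R) Om (curl Om (rr x)) <= Enorm Om x.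
Proof.
rewrite /Enorm -[leLHS]ger0_norm ?L2normv_ge0// -sqrtr_sqr ler_wsqrtr//.
set c := L2normv _ _ (curl _ _).
have := sqr_ge0 (L2norm (leb2 R) Om (rr x)); have := sqr_ge0 (L2normv (leb2 R) Om (qq x)).
have := sqr_ge0 (L2norm (leb2 R) Om (div Om (qq x))).
have := sqr_ge0 (L2norm (leb2 R) Om (pp x)); lra.
Qed.

Lemma Enorm_ge_pressure (R : realType) (Om : set (plane R)) (x : triple R) :
  L2norm (leb2 R) Om (pp x) <= Enorm Om x.
Proof.
rewrite /Enorm -[leLHS]ger0_norm ?L2norm_ge0// -sqrtr_sqr ler_wsqrtr//.
set c := L2norm _ _ (pp _).
have := sqr_ge0 (L2norm (leb2 R) Om (rr x)); have := sqr_ge0 (L2normv (leb2 R) Om (qq x)).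
have := sqr_ge0 (L2norm (leb2 R) Om (div Om (qq x))).
have := sqr_ge0 (L2normv (leb2 R) Om (curl Om (rr x))); lra.
Qed.

Theorem lemma4p5 (R : realType) (Om Gp Gq : set (plane R))
    (sg : {measure set (mplane R) -> \bar R}) (mu : R)
    (g : vector_field R) (p0 : scalar_field R) (q0 : vector_field R)
    (f : triple R -> R) (I : Type) (Th : I -> mesh R) (kap : R)
    (hOm : lipschitz_domain Om) (hsc : simply_connected Om)
    (hsg : surface_measure Om sg)
    (hGU : Gp `|` Gq = bdry Om) (hGI : Gp `&` Gq = set0)
    (hGpm : measurable (Gp : set (mplane R)))
    (hGqm : measurable (Gq : set (mplane R)))
    (hGp : Gp !=set0)
    (hrigid : forall (a : plane R) (b : R), (a, b) != (0, 0) ->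
       let phi := fun z : plane R => a + b *: ((- z.2, z.1) : plane R) in
       0 < L2norm sg Gq (fun z => dot (normal Om z) (phi z))
           + L2norm sg Gp (fun z => cross (normal Om z) (phi z)))
    (hmu : 0 < mu)
    (hg : inL2v (leb2 R) Om g)
    (hp0 : sg.-integrable Gp (EFin \o p0))
    (hq01 : sg.-integrable Gp (EFin \o (fst \o q0)))
    (hq02 : sg.-integrable Gp (EFin \o (snd \o q0)))
    (hf : load_functional sg Om Gp g p0 q0 f)
    (hTh : forall i, mesh_of Om (Th i))
    (hkap : forall i, shape_regular kap (Th i))
    (hstab : uniformly_stable mu Om Gp Th) :
  exists C : R, 0 < C /\
    forall (i : I) (xhat xh : triple R),
      solves (B mu Om) f (spaceXh Om Gp (Th i)) xhat ->
      solves (Bh mu Om (Th i)) f (spaceXh Om Gp (Th i)) xh ->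
      Enorm Om (xhat - xh) = L2normv (leb2 R) Om (qq xhat - qq xh) /\
      C * L2normv (leb2 R) Om (qq xhat - qq xh) <= mesh_size (Th i) ^+ 2.
Proof.
have [oO _ _ bO _] := hOm.
have [_ [M fM] _] := hf; have [Cs stab] := hstab.
(* One factor [Cs] bounds the error by its residual; the other one bounds the
   norm of the solution, which enters the residual, by that of the data. *)
pose K := `|Cs| * (mu^-1 * (2 * (`|Cs| * `|M|))).
have K0 : 0 <= K by rewrite !mulr_ge0// invr_ge0 ltW.
(* [K] may be 0, whence [K + 1]. *)
exists (K + 1)^-1; split=> [|i [[r q] p] [[r' q'] p'] [xX xsol] [x'X x'sol]].
  by rewrite invr_gt0; lra.
have [hr hq hp] := xX; have [hr' hq' hp'] := x'X; rewrite /rr /qq /pp /= in hr hq hp hr' hq' hp'.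
have same y : spaceXh Om Gp (Th i) y -> B mu Om (r, q, p) y = Bh mu Om (Th i) (r', q', p') y.
  by move=> yX; rewrite xsol// x'sol.
set h := mesh_size (Th i); have h0 : 0 <= h by exact: mesh_size_ge0.
pose e_r x := r x - r' x; pose e_q x := q x - q' x; pose e_p x := p x - p' x.
have eE : ((r, q, p) : triple R) - (r', q', p') = (e_r, e_q, e_p) by [].
have Eq : qq ((r, q, p) : triple R) - qq ((r', q', p') : triple R) = e_q by [].
rewrite eE Eq.
have Enorm0 y : 0 <= Enorm Om y by exact: sqrtr_ge0.
have eX : spaceXh Om Gp (Th i) (e_r, e_q, e_p).
  by split; [exact: Rh_sub|exact: Qh_sub|exact: Ph_sub].
have xbound : Enorm Om (r, q, p) <= `|Cs| * `|M|.
  apply: le_trans (stab i (r, q, p) `|M| xX _ _) _ => //; last first.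
    by rewrite ler_wpM2r// ler_norm.
  move=> y yX; rewrite xsol// (le_trans (fM y _))//; first exact: Xh_sub_X yX.
  by rewrite ler_wpM2r// ler_norm.
have e_p0 : ip (leb2 R) Om e_p e_p = 0.
  have pX : spaceXh Om Gp (Th i) (cst 0, cst 0, e_p).
    by split; [exact: Rh0|exact: Qh0|case: eX].
  (* Stability with a zero right-hand side. *)
  have := stab i _ 0 pX (lexx _); rewrite mulr0 => /(_ _)/(le_trans (Enorm_ge_pressure _ _)).
  rewrite /= /pp /L2norm => /(_ _)H; have {}H : Num.sqrt (ip (leb2 R) Om e_p e_p) <= 0.
    apply: H => y yX; rewrite (pressure_residual bO oO (hTh i) hr hr' hq hq' hp hp' same yX).
    by rewrite normr0 mul0r.
  apply/eqP; rewrite eq_le ip_ge0 andbT -sqrtr_eq0.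
  by rewrite eq_le H sqrtr_ge0.
have EE : Enorm Om (e_r, e_q, e_p) = L2normv (leb2 R) Om e_q.
  have n1 : L2norm (leb2 R) Om e_r = 0.
    by rewrite /L2norm (vorticity_error bO oO (hTh i) hmu hr hr' hq hq' hp hp' same) sqrtr0.
  have n2 : L2normv (leb2 R) Om (curl Om e_r) = 0.
    by rewrite /L2normv (curl_error bO oO (hTh i) hr hr' hq hq' hp hp' same) sqrtr0.
  have n3 : L2norm (leb2 R) Om (div Om e_q) = 0.
    by rewrite /L2norm (div_error bO oO (hTh i) hr hr' hq hq' hp hp' same) sqrtr0.
  have n4 : L2norm (leb2 R) Om e_p = 0 by rewrite /L2norm e_p0 sqrtr0.
  rewrite /Enorm /rr /qq /pp /= n1 n2 n3 n4 expr0n /= !add0r !addr0.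
  by rewrite sqrtr_sqr ger0_norm ?L2normv_ge0.
split=> //; rewrite -EE.
have res : Enorm Om (e_r, e_q, e_p) <= K * h ^+ 2.
  pose N := mu^-1 * (2 * h ^+ 2 * (`|Cs| * `|M|)).
  have N0 : 0 <= N by rewrite !mulr_ge0 ?sqr_ge0// invr_ge0 ltW.
  have -> : K * h ^+ 2 = `|Cs| * N by rewrite /K /N; ring.
  apply: le_trans (stab i (e_r, e_q, e_p) N eX N0 _) _; last by rewrite ler_wpM2r// ler_norm.
  move=> y yX; apply: le_trans (error_residual bO oO (hTh i) hmu hr hr' hq hq' hp hp' same yX) _.
  rewrite -/h /N -[leRHS]mulrA ler_wpM2l//; first by rewrite invr_ge0 ltW.
  rewrite -[leRHS]mulrA ler_wpM2l//; first by rewrite mulr_ge0// sqr_ge0.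
  apply: ler_pM; rewrite ?L2normv_ge0//; last exact: Enorm_ge_curl.
  by apply: le_trans xbound; exact: (Enorm_ge_curl Om (r, q, p)).
rewrite mulrC ler_pdivrMr; last lra.
apply: le_trans res _; rewrite mulrC ler_wpM2l ?sqr_ge0//; lra.
Qed.
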